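(* For $\mathrm{Re}(z)>1$ and $x>0$, $$\begin{aligned}&\Theta(z,x)-\Theta(z,x+1)-(x+1)^{1-z}\,\Theta\!\left(z,\frac{x}{x+1}\right)\\&=-(x+1)^{1-z}\Theta(z,1)+\left(1+x^{1-z}-(x+1)^{1-z}\right)\zeta(z+1)\\&\quad-\frac{1}{\Gamma(z-1)}\int_{0}^{\infty}t^{z-2}\left\{\mathrm{Li}_{2}\!\left(\frac{e^{-(x+1)t}-e^{-xt}}{e^{-(x+1)t}-1}\right)+\mathrm{Li}_{2}\!\left(\frac{e^{-(x+1)t}-e^{-t}}{e^{-(x+1)t}-1}\right)\right\}dt.\end{aligned}$$
   Context: For $x>0$ and $\mathrm{Re}(z)>1$, $\Theta(z,x):=\sum_{n=1}^{\infty}\sum_{m=1}^{\infty}\frac{1}{nm(n+mx)^{z-1}}$ (absolutely convergent). $\zeta$ is the Riemann zeta function. $\mathrm{Li}_2$ is the dilogarithm, $\mathrm{Li}_2(w):=-\int_0^w\frac{\log(1-u)}{u}\,du$, equal to $\sum_{n\ge1}w^n/n^2$ for $|w|<1$. *)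

(* Defs.v *)
From HB Require Import structures.
From mathcomp Require Import all_boot all_order all_algebra.
From mathcomp Require Import all_classical all_reals all_analysis.
From mathcomp Require Export complex.
Set Implicit Arguments.
Unset Strict Implicit.
Unset Printing Implicit Defensive.
Import Order.TTheory GRing.Theory Num.Theory numFieldNormedType.Exports.
Local Open Scope classical_set_scope.
Local Open Scope ring_scope.
Local Open Scope complex_scope.

Section Definitions.
Variable R : realType.

Definition cexp (z : R[i]) : R[i] :=
  (expR (complex.Re z))%:C * (cos (complex.Im z) +i* sin (complex.Im z)).

(* The principal value of a ^ s, for a real base a > 0. *)
Definition cpow (a : R) (s : R[i]) : R[i] := cexp (s * (ln a)%:C).

(* The topology used for the limit is that of R[i]^o, i.e. the one given by
   the modulus. As with every library limit, the value is only meaningful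
   when the series converges. *)
Definition cseries (u : nat -> R[i]) : R[i] :=
  limn (series (u : nat -> R[i]^o)).

Definition cintegral (D : set R) (f : R -> R[i]) : R[i] :=
  (\int[lebesgue_measure]_(t in D) complex.Re (f t))
  +i* (\int[lebesgue_measure]_(t in D) complex.Im (f t)).

(* Library series start at index 0, hence the shifts n.+1 and m.+1. *)
Definition Theta (z : R[i]) (x : R) : R[i] :=
  cseries (fun n => cseries (fun m =>
    1 / (n.+1%:R * m.+1%:R * cpow (n.+1%:R + m.+1%:R * x) (z - 1)))).

(* The Dirichlet series, which is zeta on the half-plane 1 < Re s. *)
Definition zeta (s : R[i]) : R[i] := cseries (fun n => 1 / cpow n.+1%:R s).

(* Euler's integral, which is Gamma on the half-plane 0 < Re s. *)
Definition Gamma (s : R[i]) : R[i] :=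
  cintegral `]0, +oo[ (fun t => cpow t (s - 1) * (expR (- t))%:C).

(* The dilogarithm at a real argument w <= 1. The two cases give the oriented
   integral from 0 to w. *)
Definition Li2 (w : R) : R :=
  if 0 <= w then - \int[lebesgue_measure]_(u in `[0, w]) (ln (1 - u) / u)
  else \int[lebesgue_measure]_(u in `[w, 0]) (ln (1 - u) / u).

End Definitions.

(* Main.v *)
(* With s = z - 2 and M f = the integral of t^s f(t) over the half-line, the
   value Gamma(z - 1) is M(exp(-t)), and rescaling t gives
   M(f(k .)) = k^(1 - z) M f. Expanding logarithm and dilogarithm in power
   series and integrating termwise (dominated convergence), Gamma(z - 1) times
   Theta(z, x) is M(A B) with A = -ln(1 - e^(-t)), B = -ln(1 - e^(-xt)), and
   Gamma(z - 1) zeta(z + 1) is M(Li2(e^(-t))). After rescaling, the claim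
   becomes the image under M of Abel's five-term relation for Li2 at
   a = e^(-t), b = e^(-xt). Dividing by Gamma(z - 1) requires Gamma <> 0 on
   Re s > 0: by the functional equation it is enough to look at large Re s,
   where the Gamma density is so concentrated that the oscillating factor
   t^(i Im s) cannot cancel it. *)
Require Import Defs.
From HB Require Import structures.
From mathcomp Require Import all_boot all_order all_algebra.
From mathcomp Require Import all_classical all_reals all_analysis.
From mathcomp Require Import measurable_realfun ring lra.
Set Implicit Arguments.
Unset Strict Implicit.
Unset Printing Implicit Defensive.
Import Order.TTheory GRing.Theory Num.Theory numFieldNormedType.Exports.
Local Open Scope classical_set_scope.
Local Open Scope ring_scope.
Local Open Scope complex_scope.

(** All factors multiplying [t ^ s] are real, so each integrand is a positive weight [t ^ Re s]
    times a bounded cosine or sine of [Im s * ln t]: integrability depends on [Re s] alone. The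
    range [Re s > -1] leaves room for an extra [t ^ (- e)] with small [e > 0], which absorbs the
    logarithmic singularities at 0. The series have nonnegative terms up to the oscillating factor,
    so their sums dominate the partial sums.

    With C = - ln (1 - e^(-(x + 1) t)), the logarithmic part of the five-term relation is (A - C) (B
    - C). Its four products are the four Theta values: AB and AC belong to Theta(z, x) and Theta(z,
    x + 1), while CB and CC are the products for Theta(z, x / (x + 1)) and Theta(z, 1) rescaled by x
    + 1, whence the factors (x + 1)^(1 - z). *)

Section half_line.
Variable R : realType.
Notation mu := (@lebesgue_measure R).
Local Notation Rpos := (`]0, +oo[%classic : set (measurableTypeR R)).
Implicit Types (f F : R -> R) (a b : R).

(** * Improper integrals of derivatives over the half-line *)

Lemma integral_itvcc_gt0 f F a b : 0 < a -> a < b ->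
  (forall t : R, 0 < t -> is_derive t 1 F (f t)) ->
  (forall t : R, 0 < t -> {for t, continuous f}) ->
  (\int[mu]_(t in `[a, b]) (f t)%:E = (F b)%:E - (F a)%:E)%E.
Proof.
move=> a0 ab dF cf.
have gt0 t : a <= t -> 0 < t by exact: lt_le_trans.
apply: continuous_FTC2 => //.
- apply: continuous_in_subspaceT => t;
    rewrite inE/= in_itv/= => /andP[/gt0 t0 _].
  exact: cf.
- have cF t : 0 < t -> {for t, continuous F}.
    move=> t0; apply/differentiable_continuous/derivable1_diffP.
    by have [] := dF _ t0.
  split.
  + move=> t; rewrite in_itv/= => /andP[/ltW/gt0/dF[]//].
  + by apply: cvg_at_right_filter; exact: cF.
  + by apply: cvg_at_left_filter; apply: cF; apply: gt0; exact: ltW.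
- move=> t; rewrite in_itv/= => /andP[/ltW/gt0/dF[? <- _]].
  by rewrite derive1E.
Qed.

Lemma continuous_gt0_measurable f :
  (forall t : R, 0 < t -> {for t, continuous f}) -> measurable_fun Rpos f.
Proof.
move=> cf; apply: open_continuous_measurable_fun => //.
by move=> t; rewrite inE/= in_itv/= andbT; exact: cf.
Qed.

(** The shift by 2 puts 1 strictly between the endpoints already for [n = 0], so no interval is
    degenerate. *)
Definition exhaustion (n : nat) : set R := `[(n.+2%:R)^-1, n.+2%:R].

Lemma exhaustion_nd : {homo exhaustion : n m / (n <= m)%N >-> (n <= m)%O}.
Proof.
move=> n m nm; apply/subsetPset => t; rewrite /exhaustion/= !in_itv/=.
move=> /andP[nt tn]; apply/andP; split.
  by apply: le_trans nt; rewrite lef_pV2 ?posrE// ler_nat.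
by apply: (le_trans tn); rewrite ler_nat.
Qed.

Lemma bigcup_exhaustion : \bigcup_n exhaustion n = Rpos.
Proof.
apply/seteqP; split => t /=.
  by move=> [n _]; rewrite /exhaustion/= !in_itv/= andbT => /andP[+ _];
    apply: lt_le_trans; rewrite invr_gt0.
rewrite in_itv/= andbT => t0.
exists (maxn (Num.trunc t) (Num.trunc t^-1)) => //.
rewrite /exhaustion/= in_itv/=; apply/andP; split.
  rewrite -[leRHS]invrK lef_pV2 ?posrE ?invr_gt0//.
  apply/ltW/(lt_le_trans (truncnS_gt _)); rewrite ler_nat.
  by rewrite (leq_trans _ (leqnSn _))// ltnS leq_maxr.
apply/ltW/(lt_le_trans (truncnS_gt _)); rewrite ler_nat.
by rewrite (leq_trans _ (leqnSn _))// ltnS leq_maxl.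
Qed.

Lemma exhaustion_gt0 n t : exhaustion n t -> 0 < t.
Proof.
have : Rpos t = (0 < t) :> Prop by rewrite /= in_itv/= andbT.
by rewrite -bigcup_exhaustion => <- ?; exists n.
Qed.

Lemma integral_exhaustion f F n :
  (forall t : R, 0 < t -> is_derive t 1 F (f t)) ->
  (forall t : R, 0 < t -> {for t, continuous f}) ->
  (\int[mu]_(t in exhaustion n) (f t)%:E =
   (F n.+2%:R)%:E - (F n.+2%:R^-1)%:E)%E.
Proof.
move=> dF cf; apply: integral_itvcc_gt0 => //.
by rewrite (@lt_trans _ _ 1)// ?invf_lt1// ltr1n.
Qed.

(** On each interval of the exhaustion the integral is an increment of [F], hence at most [M + M];
    monotone convergence carries the bound to the half-line. *)
Lemma integrable_derivative_bounded f F (M : R) :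
  (forall t : R, 0 < t -> is_derive t 1 F (f t)) ->
  (forall t : R, 0 < t -> {for t, continuous f}) ->
  (forall t : R, 0 < t -> 0 <= f t) ->
  (forall t : R, 0 < t -> `|F t| <= M) ->
  mu.-integrable Rpos (EFin \o f).
Proof.
move=> dF cf f0 FM; have mf := continuous_gt0_measurable cf.
apply/integrableP; split; first exact/measurable_EFinP.
under eq_integral.
  move=> t; rewrite inE/= in_itv/= andbT => t0.
  rewrite ger0_norm; last exact: f0.
  over.
apply: (@le_lt_trans _ _ (M + M)%:E); last by rewrite ltry.
rewrite -bigcup_exhaustion.
have h : (\int[mu]_(x in exhaustion i) (f x)%:E)%E @[i --> \oo] -->
    (\int[mu]_(x in \bigcup_i exhaustion i) (f x)%:E)%E.
  apply: (@ge0_nondecreasing_set_cvg_integral _ (measurableTypeR R) R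
    exhaustion (fun t => (f t)%:E) mu exhaustion_nd) => [i|i|i t /exhaustion_gt0 t0].
  - exact: measurable_itv.
  - apply: measurable_funS (measurableT_comp _ mf) => //.
    by move=> t /exhaustion_gt0 t0; rewrite /= in_itv/= t0.
  - by rewrite lee_fin f0.
rewrite -(cvg_lim _ h)//; apply: lime_le;
  first by apply/cvg_ex; eexists; exact: h.
apply: nearW => n; rewrite (integral_exhaustion _ dF cf) -EFinB lee_fin.
apply: (le_trans (ler_norm _)); apply: (le_trans (ler_normB _ _)).
by apply: lerD; apply: FM; rewrite ?invr_gt0.
Qed.

(** Here [f] may change sign, so the truncations of [f] to the exhaustion are handled by dominated
    convergence under [|f|]. *)
Lemma integral_derivative f F (l0 l1 : R) :
  (forall t : R, 0 < t -> is_derive t 1 F (f t)) ->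
  (forall t : R, 0 < t -> {for t, continuous f}) ->
  mu.-integrable Rpos (EFin \o f) ->
  F (n.+2%:R^-1) @[n --> \oo] --> l0 -> F n.+2%:R @[n --> \oo] --> l1 ->
  \int[mu]_(t in Rpos) f t = l1 - l0.
Proof.
move=> dF cf fi F0 F1.
have mE n : measurable (exhaustion n) by exact: measurable_itv.
have mf := continuous_gt0_measurable cf.
have sub n : exhaustion n `<=` Rpos.
  by move=> t /exhaustion_gt0 t0; rewrite /= in_itv/= t0.
have cv : (\int[mu]_(t in Rpos) ((f \_ (exhaustion n)) t)%:E)%E
    @[n --> \oo] --> (\int[mu]_(t in Rpos) (f t)%:E)%E.
  apply: (@dominated_cvg _ _ _ mu _ _ (fun n => EFin \o (f \_ (exhaustion n)))
    _ (fun t => `|(f t)%:E|%E)).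
  - exact: measurable_itv.
  - move=> n; apply/measurable_EFinP/measurable_restrict => //.
      exact: measurable_itv.
    by apply: measurable_funS mf => //; move=> t [].
  - move=> t; rewrite -bigcup_exhaustion => -[m _ mt].
    apply: cvg_near_cst; near=> n; rewrite /= patchE mem_set//.
    have /exhaustion_nd/subsetPset : (m <= n)%N by near: n;
      exact: nbhs_infty_ge.
    exact.
  - by [].
  - exact: integrable_abse.
  - move=> n t _; rewrite /= patchE lee_fin; case: ifPn => //.
    by rewrite normr0.
have {}cv : ((F n.+2%:R - F n.+2%:R^-1)%:E)%E @[n --> \oo] -->
    (\int[mu]_(t in Rpos) (f t)%:E)%E.
  apply: cvg_trans cv; apply: near_eq_cvg; apply: nearW => n.
  rewrite EFinB -(integral_exhaustion _ dF cf).
  transitivity (\int[mu]_(t in Rpos) ((EFin \o f) \_ (exhaustion n)) t)%E.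
    by rewrite restrict_EFin.
  by rewrite -integral_mkcondr setIidr.
have cl : ((F n.+2%:R - F n.+2%:R^-1)%:E)%E @[n --> \oo] --> (l1 - l0)%:E.
  by apply: cvg_EFin; [exact: nearW|exact: cvgB].
by rewrite /Rintegral -(cvg_unique _ cl cv).
Unshelve. all: by end_near. Qed.
End half_line.

(** * The substitution [t -> k * t] *)

Section scaling.
Variable R : realType.
Notation mu := (@lebesgue_measure R).
Local Notation Rpos := (`]0, +oo[%classic : set (measurableTypeR R)).
Variable k : R.
Hypothesis k_gt0 : 0 < k.

Let scale : measurableTypeR R -> measurableTypeR R := fun t => k * t.

Let measurable_scale : measurable_fun setT scale.
Proof. exact: measurable_funM. Qed.

Let image : {measure set (measurableTypeR R) -> \bar R} :=
  measure_function_pushforward__canonical__measure_function_Measure mu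
    measurable_scale.

(** Lebesgue measure is determined on the intervals []a, b]]; the preimage of one under
    multiplication by [k] has length [(b - a) / k], which [mscale] multiplies back by [k]. *)
Lemma lebesgue_measure_scale (A : set R) : measurable A ->
  mscale (NngNum (ltW k_gt0)) image A = mu A.
Proof.
move=> mA; apply/esym/lebesgue_measure_unique => //= _ [[a b]] _ <-.
rewrite /mscale/= /image/= /pushforward
  (_ : _ @^-1` _ = `]a / k, b / k]%classic).
  rewrite !lebesgue_measure_itv/= !lte_fin ltr_pM2r ?invr_gt0//.
  case: ifPn => _; last by rewrite mule0.
  by rewrite -!EFinB -EFinM -mulrBl mulrCA divff ?gt_eqF// mulr1.
apply/seteqP; split => t; rewrite /scale/= !in_itv/= => /andP[at_ tb];
  apply/andP;
  split.
- by rewrite ltr_pdivrMr// mulrC.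
- by rewrite ler_pdivlMr// mulrC.
- by rewrite mulrC -ltr_pdivrMr.
- by rewrite mulrC -ler_pdivlMr.
Qed.

Let scale_preimage : scale @^-1` Rpos = Rpos.
Proof.
by apply/seteqP; split => t; rewrite /= !in_itv/= !andbT pmulr_rgt0.
Qed.

Let mRpos : measurable Rpos. Proof. exact: measurable_itv. Qed.

Lemma ge0_integral_scale (f : R -> \bar R) : measurable_fun Rpos f ->
  (forall t, Rpos t -> (0 <= f t)%E) ->
  (\int[mu]_(t in Rpos) f (k * t)%R = k^-1%:E * \int[mu]_(t in Rpos) f t)%E.
Proof.
move=> mf f0.
have -> : (\int[mu]_(t in Rpos) f t =
    \int[mscale (NngNum (ltW k_gt0)) image]_(t in Rpos) f t)%E.
  by apply: eq_measure_integral => A mA _; exact/esym/lebesgue_measure_scale.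
rewrite (ge0_integral_mscale image)// /image/=.
rewrite (ge0_integral_pushforward measurable_scale)//=.
  by rewrite muleA -EFinM mulVf ?gt_eqF// mul1e scale_preimage.
by move=> t; rewrite inE; exact: f0.
Qed.

Lemma integrable_scale (f : R -> R) : mu.-integrable Rpos (EFin \o f) ->
  mu.-integrable Rpos (fun t => (f (k * t))%:E).
Proof.
move=> /integrableP[mf fi]; apply/integrableP; split.
  have ms : measurable_fun Rpos scale by exact: measurable_funTS.
  apply: (measurable_comp mRpos _ mf ms).
  by move=> _ [t + <-]; rewrite -[X in X -> _]/(Rpos t) -{1}scale_preimage.
rewrite (ge0_integral_scale (f := fun t => `|(f t)%:E|%E))//.
  by apply: lte_mul_pinfty => //; rewrite lee_fin invr_ge0 ltW.
exact: measurableT_comp.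
Qed.

Lemma Rintegral_scale (f : R -> R) : mu.-integrable Rpos (EFin \o f) ->
  \int[mu]_(t in Rpos) f (k * t) = k^-1 * \int[mu]_(t in Rpos) f t.
Proof.
move=> fi; have mf := measurable_int _ fi.
have mp := measurable_funepos mf; have mn := measurable_funeneg mf.
have pf := integrable_pos_fin_num mRpos fi.
have nf := integrable_neg_fin_num mRpos fi.
have E : (\int[mu]_(t in Rpos) (f (k * t))%:E =
    k^-1%:E * \int[mu]_(t in Rpos) (f t)%:E)%E.
  rewrite [X in _ = (_ * X)%E]integralE muleBr//; last first.
    by rewrite fin_num_adde_defl// fin_numN.
  rewrite -ge0_integral_scale// -ge0_integral_scale//.
  rewrite [LHS]integralE; congr (_ - _)%E; apply: eq_integral => t _.
    by rewrite !funeposE.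
  by rewrite !funenegE.
rewrite /Rintegral E fineM//.
exact: integrable_fin_num.
Qed.
End scaling.

(** * Complex series through real and imaginary parts *)

Section complex_series.
Variable R : realType.
Implicit Types (u : nat -> R[i]) (l s : R[i]) (a b : R).

Lemma normc_le_ReIm l : `|l| <= (`|complex.Re l| + `|complex.Im l|)%:C.
Proof.
case: l => a b; rewrite normc_def lecR/=.
rewrite -[leRHS]ger0_norm ?addr_ge0// -sqrtr_sqr ler_sqrt ?sqr_ge0//.
rewrite -[a ^+ 2]real_normK ?num_real// -[b ^+ 2]real_normK ?num_real//.
by have := normr_ge0 a; have := normr_ge0 b; nra.
Qed.

Lemma cvg_complex u l :
  complex.Re (u n) @[n --> \oo] --> complex.Re l ->
  complex.Im (u n) @[n --> \oo] --> complex.Im l ->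
  (u : nat -> R[i]^o) n @[n --> \oo] --> (l : R[i]^o).
Proof.
move=> /cvgrPdist_lt ur /cvgrPdist_lt ui; apply/cvgrPdist_lt => -[e e'].
rewrite ltcE/= => /andP[/eqP-> e0]; have e20 : 0 < e / 2 by rewrite divr_gt0.
near=> n; apply: le_lt_trans (normc_le_ReIm _) _; rewrite ltcR.
rewrite [ltRHS](splitr e); apply: ltrD.
  have -> : complex.Re (l - u n) = complex.Re l - complex.Re (u n).
    by case: (l) => ? ?; case: (u n).
  by near: n; exact: ur.
have -> : complex.Im (l - u n) = complex.Im l - complex.Im (u n).
  by case: (l) => ? ?; case: (u n).
by near: n; exact: ui.
Unshelve. all: by end_near. Qed.

Lemma Re_series u n : complex.Re (series u n) = series (fun k => complex.Re
  (u k)) n.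
Proof.
rewrite /series/=; elim: n => [|n IH]; first by rewrite !big_nil.
by rewrite !big_nat_recr//= -IH; case: (\sum_(_ <= _ < _) _); case: (u n).
Qed.

Lemma Im_series u n : complex.Im (series u n) = series (fun k => complex.Im
  (u k)) n.
Proof.
rewrite /series/=; elim: n => [|n IH]; first by rewrite !big_nil.
by rewrite !big_nat_recr//= -IH; case: (\sum_(_ <= _ < _) _); case: (u n).
Qed.

Lemma cvg_cseries u l :
  series (fun k => complex.Re (u k)) n @[n --> \oo] --> complex.Re l ->
  series (fun k => complex.Im (u k)) n @[n --> \oo] --> complex.Im l ->
  (series u : nat -> R[i]^o) n @[n --> \oo] --> (l : R[i]^o).
Proof.
move=> ur ui; apply: cvg_complex.
  by under eq_fun do rewrite Re_series.
by under eq_fun do rewrite Im_series.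
Qed.

Lemma cseriesE u l :
  (series u : nat -> R[i]^o) n @[n --> \oo] --> (l : R[i]^o) -> cseries u = l.
Proof. by move=> /cvg_lim; apply; exact: norm_hausdorff. Qed.

Lemma cseriesZ u l s :
  (series u : nat -> R[i]^o) n @[n --> \oo] --> (l : R[i]^o) ->
  cseries (fun n => s * u n) = s * l.
Proof.
move=> ul; apply: cseriesE.
have -> : series (fun n => s * u n) = (fun n => s * series u n).
  by apply/funext => n; rewrite /series/= mulr_sumr.
exact: (@cvgMr R[i] _ \oo _ (series u : nat -> R[i]^o)  s l ul).
Qed.

End complex_series.

(** * Complex powers of a real base *)

Section complex_power.
Variable R : realType.
Implicit Types (s : R[i]) (a b : R).

Lemma cexpD s s' : cexp (s + s') = cexp s * cexp s'.
Proof.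
case: s => a b; case: s' => a' b'; rewrite /cexp/= expRD cosD sinD.
by apply/eqP; rewrite eq_complex/=; apply/andP; split; apply/eqP; ring.
Qed.

Lemma cexp0 : cexp 0 = 1 :> R[i].
Proof. by rewrite /cexp/= expR0 cos0 sin0 mulr1. Qed.

Lemma cpowD a s s' : cpow a (s + s') = cpow a s * cpow a s'.
Proof. by rewrite /cpow mulrDl cexpD. Qed.

Lemma cpow0 a : cpow a (0 : R[i]) = 1.
Proof. by rewrite /cpow mul0r cexp0. Qed.

Lemma cpowM a b s : 0 < a -> 0 < b -> cpow (a * b) s = cpow a s * cpow b s.
Proof. by move=> a0 b0; rewrite /cpow lnM ?posrE// rmorphD mulrDr cexpD. Qed.

Lemma cpowN a s : cpow a (- s) = (cpow a s)^-1.
Proof.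
have h : cpow a (- s) * cpow a s = 1 by rewrite -cpowD addNr cpow0.
have n0 : cpow a s != 0.
  by apply/eqP => h0; move: h; rewrite h0 mulr0 => /eqP;
    rewrite eq_sym oner_eq0.
by rewrite -[LHS]mulr1 -(divff n0) mulrA h mul1r.
Qed.

Lemma cpowr1 a : 0 < a -> cpow a (1 : R[i]) = a%:C.
Proof.
by move=> a0; rewrite /cpow mul1r /cexp/= lnK// cos0 sin0 complexr0 mulr1.
Qed.

Lemma ReM_real s a : complex.Re (s * a%:C) = complex.Re s * a.
Proof. by case: s => x y /=; rewrite mulr0 subr0. Qed.

Lemma ImM_real s a : complex.Im (s * a%:C) = complex.Im s * a.
Proof. by case: s => x y /=; rewrite mulr0 add0r. Qed.

Lemma Re_cpow a s : complex.Re (cpow a s) =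
  expR (complex.Re s * ln a) * cos (complex.Im s * ln a).
Proof. by rewrite /cpow /cexp ReM_real ImM_real/= mul0r subr0. Qed.

Lemma Im_cpow a s : complex.Im (cpow a s) =
  expR (complex.Re s * ln a) * sin (complex.Im s * ln a).
Proof. by rewrite /cpow /cexp ReM_real ImM_real/= mul0r addr0. Qed.

End complex_power.

(** * Integrals with a bounded oscillating factor *)

Section bounded_multiplier.
Variable R : realType.
Notation mu := (@lebesgue_measure R).
Local Notation Rpos := (`]0, +oo[%classic : set (measurableTypeR R)).
Implicit Types f g h : R -> R.

Let mRpos : measurable Rpos. Proof. exact: measurable_itv. Qed.

Lemma integrable_bounded_mul h g : measurable_fun setT h ->
  (forall t, `|h t| <= 1) -> mu.-integrable Rpos (EFin \o g) ->
  mu.-integrable Rpos (EFin \o (fun t => h t * g t)).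
Proof.
move=> mh h1 gi.
have /measurable_EFinP mg := measurable_int _ gi.
apply: le_integrable gi => //.
  apply/measurable_EFinP; apply: measurable_funM => //.
  exact: measurable_funTS.
by move=> t _; rewrite lee_fin normrM ler_piMl.
Qed.

Lemma integrable_le_gt0 f g : measurable_fun Rpos f ->
  (forall t : R, 0 < t -> `|f t| <= g t) -> mu.-integrable Rpos (EFin \o g) ->
  mu.-integrable Rpos (EFin \o f).
Proof.
move=> mf fg; apply: le_integrable => //; first exact/measurable_EFinP.
move=> t /=; rewrite in_itv/= andbT => /fg/le_trans; rewrite lee_fin; apply.
exact: ler_norm.
Qed.

(** Only [h] oscillates: the partial sums of [g_] stay between 0 and [g], so [g] dominates [h] times
    any of them. *)
Lemma cvg_series_Rintegral h (g_ : nat -> R -> R) g : measurable_fun setT h ->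
  (forall t, `|h t| <= 1) -> (forall n, measurable_fun Rpos (g_ n)) ->
  (forall n (t : R), 0 < t -> 0 <= g_ n t) ->
  (forall t : R, 0 < t -> series (g_ ^~ t) n @[n --> \oo] --> g t) ->
  mu.-integrable Rpos (EFin \o g) ->
  series (fun n => \int[mu]_(t in Rpos) (h t * g_ n t)) n @[n --> \oo] -->
  \int[mu]_(t in Rpos) (h t * g t).
Proof.
move=> mh h1 mg g0 cg gi.
have sum_le n (t : R) : 0 < t -> series (g_ ^~ t) n <= g t.
  move=> t0; rewrite -(cvg_lim _ (cg _ t0))//; apply: nondecreasing_cvgn_le.
    by apply/nondecreasing_seqP => k;
      rewrite /series/= big_nat_recr//= lerDl g0.
  by apply/cvg_ex; exists (g t); exact: cg.
have sum_ge0 n (t : R) : 0 < t -> 0 <= series (g_ ^~ t) n.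
  by move=> t0; apply: sumr_ge0 => k _; exact: g0.
have g_le n (t : R) : 0 < t -> `|g_ n t| <= g t.
  move=> t0; rewrite ger0_norm ?g0//; apply: le_trans (sum_le n.+1 t t0).
  by rewrite /series/= big_nat_recr//= lerDr; exact: sum_ge0.
have igi n : mu.-integrable Rpos (EFin \o g_ n).
  exact: integrable_le_gt0 (g_le n) gi.
have msum n : measurable_fun Rpos (fun t => series (g_ ^~ t) n).
  exact: measurable_sum.
have isum n : mu.-integrable Rpos (EFin \o (fun t => series (g_ ^~ t) n)).
  apply: integrable_le_gt0 gi => // t t0.
  by rewrite ger0_norm ?sum_ge0//; exact: sum_le.
have -> : series (fun n => \int[mu]_(t in Rpos) (h t * g_ n t)) =
    fun n => \int[mu]_(t in Rpos) (h t * series (g_ ^~ t) n).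
  apply/funext; elim => [|n IH].
    rewrite /series/= big_nil; under eq_Rintegral do rewrite big_nil mulr0.
    by rewrite Rintegral_cst// mul0r.
  rewrite {1}/series/= big_nat_recr//= -[X in X + _]/(series _ n) IH.
  under [RHS]eq_Rintegral do rewrite /series/= big_nat_recr//= mulrDr.
  rewrite RintegralD//.
    exact: (integrable_bounded_mul mh h1 (isum n)).
  exact: (integrable_bounded_mul mh h1 (igi n)).
apply: fine_cvg; rewrite fineK; last first.
  apply: integrable_fin_num => //.
  exact: (integrable_bounded_mul mh h1 gi).
apply: (@dominated_cvg _ _ _ mu _ _
    (fun n => EFin \o (fun t => h t * series (g_ ^~ t) n)) _ (EFin \o g)) => //.
- move=> n; apply/measurable_EFinP; apply: measurable_funM => //.
  exact: measurable_funTS.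
- move=> t; rewrite /= in_itv/= andbT => t0; apply: cvg_EFin;
    first exact: nearW.
  by apply: cvgMr; exact: cg.
- move=> n t; rewrite /= in_itv/= andbT => t0; rewrite lee_fin normrM.
  apply: (le_trans (ler_piMl _ (h1 _))) => //.
  by rewrite ger0_norm ?sum_ge0//; exact: sum_le.
Qed.

End bounded_multiplier.

(** * The Mellin transform *)

Section mellin.
Variable R : realType.
Notation mu := (@lebesgue_measure R).
Local Notation Rpos := (`]0, +oo[%classic : set (measurableTypeR R)).
Implicit Types (f g : R -> R) (p : R) (s c : R[i]).

Let mRpos : measurable Rpos. Proof. exact: measurable_itv. Qed.

(** The exponent is [s] and not the customary [s - 1]: this is the classical transform at
    [s + 1]. *)
Definition mellin s f : R[i] :=
  cintegral `]0, +oo[ (fun t => cpow t s * (f t)%:C).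

(** Only the modulus [t ^ Re s] matters, hence a real [p]; the power is spelled out to match
    [Re_cpow] and [Im_cpow]. *)
Definition mellin_integrable p f :=
  mu.-integrable Rpos (EFin \o (fun t => expR (p * ln t) * f t)).

Lemma measurable_cosln p : measurable_fun setT (fun t : R => cos (p * ln t)).
Proof.
apply: measurableT_comp; last exact: measurable_funM.
by apply: continuous_measurable_fun; exact: continuous_cos.
Qed.

Lemma measurable_sinln p : measurable_fun setT (fun t : R => sin (p * ln t)).
Proof.
apply: measurableT_comp; last exact: measurable_funM.
by apply: continuous_measurable_fun; exact: continuous_sin.
Qed.

Lemma cosln_le1 (p t : R) : `|cos (p * ln t)| <= 1.
Proof. by rewrite ler_norml cos_geN1 cos_le1. Qed.

Lemma sinln_le1 (p t : R) : `|sin (p * ln t)| <= 1.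
Proof. by rewrite ler_norml sin_geN1 sin_le1. Qed.

#[local] Hint Resolve measurable_cosln measurable_sinln cosln_le1 sinln_le1 :
  core.

Lemma measurable_expRln p : measurable_fun setT (fun t : R => expR (p * ln t)).
Proof. by apply: measurableT_comp => //; exact: measurable_funM. Qed.

Lemma mellinE s f : mellin s f =
  (\int[mu]_(t in Rpos) (cos (complex.Im s * ln t) *
                         (expR (complex.Re s * ln t) * f t))) +i*
  (\int[mu]_(t in Rpos) (sin (complex.Im s * ln t) *
                         (expR (complex.Re s * ln t) * f t))).
Proof.
congr (_ +i* _); apply: eq_Rintegral => t _.
  by rewrite ReM_real Re_cpow mulrCA mulrA mulrC mulrA.
by rewrite ImM_real Im_cpow mulrCA mulrA mulrC mulrA.
Qed.

Lemma eq_mellin s f g : (forall t : R, 0 < t -> f t = g t) ->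
  mellin s f = mellin s g.
Proof.
move=> fg; rewrite !mellinE; congr (_ +i* _); apply: eq_Rintegral => t;
  by rewrite inE/= in_itv/= andbT => /fg->.
Qed.

Lemma eq_mellin_integrable p f g : (forall t : R, 0 < t -> f t = g t) ->
  mellin_integrable p f -> mellin_integrable p g.
Proof.
move=> fg; apply: eq_integrable => // t.
by rewrite inE/= in_itv/= andbT => /fg->.
Qed.

Lemma mellin_integrableD p f g : mellin_integrable p f ->
  mellin_integrable p g -> mellin_integrable p (fun t => f t + g t).
Proof.
move=> fi gi; have := integrableD mRpos fi gi.
by apply: eq_integrable => // t _; rewrite /= -EFinD mulrDr.
Qed.

Lemma mellin_integrableZ p (c : R) f : mellin_integrable p f ->
  mellin_integrable p (fun t => c * f t).
Proof.
move=> fi; have := integrableZl mRpos c fi.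
by apply: eq_integrable => // t _; rewrite /= -EFinM mulrCA.
Qed.

Lemma mellin_integrableB p f g : mellin_integrable p f ->
  mellin_integrable p g -> mellin_integrable p (fun t => f t - g t).
Proof.
move=> fi /(mellin_integrableZ (-1)) /(mellin_integrableD fi).
by apply: eq_mellin_integrable => t _; rewrite mulN1r.
Qed.

Lemma mellin_integrable_le p f g : measurable_fun Rpos f ->
  (forall t : R, 0 < t -> `|f t| <= g t) ->
  mellin_integrable p g -> mellin_integrable p f.
Proof.
move=> mf fg; apply: integrable_le_gt0.
  apply: measurable_funM => //; apply: measurable_funTS.
  exact: measurable_expRln.
by move=> t t0; rewrite normrM ger0_norm ?expR_ge0// ler_pM2l ?expR_gt0// fg.
Qed.

Lemma mellinD s f g :
  mellin_integrable (complex.Re s) f -> mellin_integrable (complex.Re s) g ->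
  mellin s (fun t => f t + g t) = mellin s f + mellin s g.
Proof.
move=> fi gi; rewrite !mellinE; apply/eqP; rewrite eq_complex/=.
under eq_Rintegral do rewrite !mulrDr.
under [X in _ && (X == _)]eq_Rintegral do rewrite !mulrDr.
by rewrite !RintegralD ?eqxx//; exact: integrable_bounded_mul.
Qed.

Lemma mellinZ s (c : R) f : mellin_integrable (complex.Re s) f ->
  mellin s (fun t => c * f t) = c%:C * mellin s f.
Proof.
move=> fi; rewrite !mellinE; apply/eqP; rewrite eq_complex/= !mul0r subr0 addr0.
apply/andP; split; apply/eqP; rewrite -RintegralZl//;
  try exact: integrable_bounded_mul; by apply: eq_Rintegral => t _; ring.
Qed.

Lemma mellinB s f g :
  mellin_integrable (complex.Re s) f -> mellin_integrable (complex.Re s) g ->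
  mellin s (fun t => f t - g t) = mellin s f - mellin s g.
Proof.
move=> fi gi; under [LHS]eq_mellin do rewrite -mulN1r.
rewrite mellinD//; last exact: mellin_integrableZ.
by rewrite mellinZ// rmorphN rmorph1 mulN1r.
Qed.

Lemma mellin_series s (f_ : nat -> R -> R) f :
  (forall n, measurable_fun Rpos (f_ n)) ->
  (forall n (t : R), 0 < t -> 0 <= f_ n t) ->
  (forall t : R, 0 < t -> series (f_ ^~ t) n @[n --> \oo] --> f t) ->
  mellin_integrable (complex.Re s) f ->
  (series (fun n => mellin s (f_ n)) : nat -> R[i]^o) n @[n --> \oo] -->
    (mellin s f : R[i]^o).
Proof.
move=> mf f0 cf fi.
have mg n : measurable_fun Rpos (fun t => expR (complex.Re s * ln t) * f_ n t).
  apply: measurable_funM => //; apply: measurable_funTS.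
  exact: measurable_expRln.
have g0 n (t : R) : 0 < t -> 0 <= expR (complex.Re s * ln t) * f_ n t.
  by move=> t0; rewrite mulr_ge0 ?expR_ge0// f0.
have cg (t : R) : 0 < t ->
    series (fun n => expR (complex.Re s * ln t) * f_ n t) n @[n --> \oo] -->
    expR (complex.Re s * ln t) * f t.
  move=> t0; rewrite (_ : series _ = fun n =>
    expR (complex.Re s * ln t) * series (f_ ^~ t) n);
    first by apply: cvgMr; exact: cf.
  by apply/funext => n; rewrite /series/= mulr_sumr.
apply: cvg_cseries; rewrite mellinE.
  under eq_fun do under eq_fun do rewrite mellinE.
  exact: (cvg_series_Rintegral _ _ mg g0 cg fi).
under eq_fun do under eq_fun do rewrite mellinE.
exact: (cvg_series_Rintegral _ _ mg g0 cg fi).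
Qed.

Lemma cintegralZ c (F : R -> R[i]) :
  mu.-integrable Rpos (EFin \o (fun t => complex.Re (F t))) ->
  mu.-integrable Rpos (EFin \o (fun t => complex.Im (F t))) ->
  cintegral `]0, +oo[ (fun t => c * F t) = c * cintegral `]0, +oo[ F.
Proof.
move=> Fr Fi; case: c => a b; rewrite /cintegral.
have ir (k : R) (f : R -> R) : mu.-integrable Rpos (EFin \o f) ->
    mu.-integrable Rpos (EFin \o (fun t => k * f t)).
  by move=> /(integrableZl mRpos k).
apply/eqP; rewrite eq_complex/=; apply/andP; split; apply/eqP.
  rewrite -RintegralZl// -[X in _ - X]RintegralZl// -RintegralB//;
    try exact: ir.
  by apply: eq_Rintegral => t _; case: (F t).
rewrite -RintegralZl// -[X in _ + X]RintegralZl// -RintegralD//; try exact: ir.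
by apply: eq_Rintegral => t _; case: (F t).
Qed.

Lemma mellin_integrable_Re s f : mellin_integrable (complex.Re s) f ->
  mu.-integrable Rpos (EFin \o (fun t => complex.Re (cpow t s * (f t)%:C))).
Proof.
move=> fi; have := integrable_bounded_mul (measurable_cosln (complex.Im s))
  (cosln_le1 _) fi.
by apply: eq_integrable => // t _; congr (_%:E); rewrite ReM_real Re_cpow; ring.
Qed.

Lemma mellin_integrable_Im s f : mellin_integrable (complex.Re s) f ->
  mu.-integrable Rpos (EFin \o (fun t => complex.Im (cpow t s * (f t)%:C))).
Proof.
move=> fi; have := integrable_bounded_mul (measurable_sinln (complex.Im s))
  (sinln_le1 _) fi.
by apply: eq_integrable => // t _; congr (_%:E); rewrite ImM_real Im_cpow; ring.
Qed.

Lemma mellin_integrable_scale (k p : R) f : 0 < k -> mellin_integrable p f ->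
  mellin_integrable p (fun t => f (k * t)).
Proof.
move=> k0 /(integrable_scale k0) /(integrableZl mRpos (expR (- (p * ln k)))).
apply: eq_integrable => // t; rewrite inE/= in_itv/= andbT => t0.
by rewrite -EFinM mulrA -expRD lnM// mulrDr addKr.
Qed.

Lemma mellin_scale (k : R) s f : 0 < k -> mellin_integrable (complex.Re s) f ->
  mellin s (fun t => f (k * t)) = cpow k (- s - 1) * mellin s f.
Proof.
move=> k0 fi.
transitivity (cpow k (- s) *
    cintegral `]0, +oo[ (fun t => cpow (k * t) s * (f (k * t))%:C)).
  rewrite -cintegralZ.
  - have gt0 (t : R) : t \in Rpos -> 0 < t by rewrite inE/= in_itv/= andbT.
    congr (_ +i* _); apply: eq_Rintegral => t /gt0 t0;
    by rewrite cpowM// (mulrA (cpow k _)) (mulrA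
      (cpow k _)) -cpowD addNr cpow0 mul1r.
  - exact: (integrable_scale k0 (mellin_integrable_Re fi)).
  - exact: (integrable_scale k0 (mellin_integrable_Im fi)).
rewrite cpowD -mulrA; congr (_ * _); rewrite /cintegral.
rewrite (Rintegral_scale k0 (mellin_integrable_Re fi)).
rewrite (Rintegral_scale k0 (mellin_integrable_Im fi)).
rewrite cpowN cpowr1// -fmorphV.
by apply/eqP; rewrite eq_complex/= !mul0r subr0 addr0 !eqxx.
Qed.

End mellin.

(** * Derivative rules for functions written pointwise *)

Section derivative_rules.
Variable R : realType.
Implicit Types (f g : R -> R) (x a b : R).

Lemma is_derive_add f g x a b : is_derive x 1 f a -> is_derive x 1 g b ->
  is_derive x 1 (fun t => f t + g t) (a + b).
Proof. exact: is_deriveD. Qed.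

Lemma is_derive_opp f x a : is_derive x 1 f a ->
  is_derive x 1 (fun t => - f t) (- a).
Proof. exact: is_deriveN. Qed.

Lemma is_derive_mul f g x a b : is_derive x 1 f a -> is_derive x 1 g b ->
  is_derive x 1 (fun t => f t * g t) (a * g x + f x * b).
Proof.
by move=> fa gb; apply: (is_derive_eq (is_deriveM fa gb)); rewrite addrC mulrC.
Qed.

Lemma is_derive_inv f x a : f x != 0 -> is_derive x 1 f a ->
  is_derive x 1 (fun t => (f t)^-1) (- a / f x ^+ 2).
Proof.
by move=> fx fa; apply: (is_derive_eq (is_deriveV fx fa));
  rewrite /GRing.scale/= mulrC mulrN mulNr.
Qed.

Lemma is_derive_comp_ln f x a : 0 < f x -> is_derive x 1 f a ->
  is_derive x 1 (fun t => ln (f t)) (a / f x).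
Proof.
by move=> fx fa; rewrite mulrC; apply: is_derive1_comp; exact: is_derive1_ln.
Qed.

Lemma is_derive_comp_cos f x a : is_derive x 1 f a ->
  is_derive x 1 (fun t => cos (f t)) (- sin (f x) * a).
Proof. by move=> fa; apply: is_derive1_comp. Qed.

Lemma is_derive_comp_sin f x a : is_derive x 1 f a ->
  is_derive x 1 (fun t => sin (f t)) (cos (f x) * a).
Proof. by move=> fa; apply: is_derive1_comp. Qed.

Lemma is_derive_cont f x a : is_derive x 1 f a -> {for x, continuous f}.
Proof.
by move=> [fx _]; apply/differentiable_continuous/derivable1_diffP.
Qed.

Lemma MVT0 f (df : R -> R) b : 0 < b ->
  (forall x, 0 < x < b -> is_derive x 1 f (df x)) ->
  {within `[0, b], continuous f} ->
  exists2 c, 0 < c < b & f b - f 0 = df c * b.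
Proof.
move=> b0 fdf cf; have fdf' x : x \in `]0, b[ -> is_derive x 1 f (df x).
  by rewrite in_itv/=; exact: fdf.
by have [c] := MVT b0 fdf' cf; rewrite in_itv/= subr0; exists c.
Qed.

End derivative_rules.

(** * Elementary inequalities *)

Section inequalities.
Variable R : realType.
Implicit Types (x w t p q c : R).

(** Mean value theorem: the derivative of the right side is the sum of a positive number and its
    inverse, hence at least 2. *)
Lemma sinh_ge w : 0 <= w -> 2 * w <= expR w - expR (- w).
Proof.
rewrite le_eqVlt => /predU1P[<-|w0]; first by rewrite oppr0 mulr0 subrr.
pose f t := expR t - expR (- t).
have df t : is_derive t 1 f (expR t + expR (- t)).
  by apply: is_derive_eq; rewrite mulrN1 opprK.
have [|c _] := MVT0 w0 (fun t _ => df t).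
  by apply: derivable_within_continuous => t _; have [] := df t.
rewrite /f oppr0 expR0 subrr subr0 => ->; rewrite ler_pM2r//.
have := expR_gt0 c; have : expR c * expR (- c) = 1
  by rewrite -expRD subrr expR0.
move: (expR c) (expR (- c)) => a b ab a0; rewrite -(ler_pM2l a0).
by have := sqr_ge0 (a - 1); nra.
Qed.

(** At [x = exp (2 w)] the right side is [(exp w - exp (- w)) ^ 2], to which [sinh_ge] applies. It
    lets the means of [t] and [1 / t] control the spread of [ln t]. *)
Lemma ln_sqr_le x : 0 < x -> ln x ^+ 2 <= x + x^-1 - 2.
Proof.
move=> x0; rewrite -[x in leRHS]lnK// -expRN; move: (ln x) => v.
wlog v0 : v / 0 <= v.
  move=> h; have [/h//|v0] := leP 0 v.
  by have := h (- v); rewrite sqrrN opprK (addrC (expR (- v))); apply; lra.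
have [w w0 ->] : exists2 w, 0 <= w & v = w + w by exists (v / 2); lra.
have := sinh_ge w0; rewrite opprD !expRD.
have : expR w * expR (- w) = 1 by rewrite -expRD subrr expR0.
by move: (expR w) (expR (- w)) => a b; nra.
Qed.

Lemma sin_sqr_le x : sin x ^+ 2 <= x ^+ 2.
Proof.
wlog x0 : x / 0 <= x.
  move=> h; have [/h//|x0] := leP 0 x.
  by have := h (- x); rewrite sinN !sqrrN; apply; lra.
move: x0; rewrite le_eqVlt => /predU1P[<-|x0]; first by rewrite sin0.
have [|c _] := MVT0 x0 (fun t _ => is_derive_sin t).
  by apply: derivable_within_continuous => t _.
by rewrite sin0 subr0 => ->; rewrite exprMn ler_piMl ?sqr_ge0.
Qed.

(** By [cos x = 1 - 2 sin (x / 2) ^ 2] and [sin_sqr_le]. *)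
Lemma cos_ge x : 1 - x ^+ 2 / 2 <= cos x.
Proof.
have := sin_sqr_le (x / 2); rewrite sin2cos2.
have := cos_mulr2n (x / 2); have -> : x / 2 *+ 2 = x by lra.
by move=> ->; lra.
Qed.

(** The inequality [ln y < y] at [y = (c / q) * t], multiplied by [q], bounds [q * ln t - c * t] by
    [- q * ln (c / q)]. *)
Lemma expR_lnM_le q c : 0 < q -> 0 < c ->
  exists2 K, 0 < K & forall t, 0 < t -> expR (q * ln t) * expR (- (c * t)) <= K.
Proof.
move=> q0 c0; exists (expR (- q * ln (c / q))); first exact: expR_gt0.
move=> t t0; rewrite -expRD ler_expR.
have cq : 0 < c / q by rewrite divr_gt0.
have := ln_sublinear (mulr_gt0 cq t0).
have -> : ln (c / q * t) = ln (c / q) + ln t by rewrite lnM ?posrE.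
move: (ln (c / q)) (ln t) => u v /ltW;
  rewrite -(ler_pM2l q0) mulrA (mulrC q (c / q)) divfK ?gt_eqF//.
by lra.
Qed.

End inequalities.

(** * Euler's integral: convergence, functional equation, absence of zeros *)

Section gamma.
Variable R : realType.
Notation mu := (@lebesgue_measure R).
Local Notation Rpos := (`]0, +oo[%classic : set (measurableTypeR R)).
Implicit Types (p q c t : R) (s : R[i]).

Let mRpos : measurable Rpos. Proof. exact: measurable_itv. Qed.

Let kernel t := expR (- t).

(** The majorant is a multiple of [(p + 1) t ^ p / (1 + t ^ (p + 1)) ^ 2], the derivative of the
    bounded function [- 1 / (1 + t ^ (p + 1))]. *)
Lemma mellin_integrable_expR p c : -1 < p -> 0 < c ->
  mellin_integrable p (fun t => expR (- (c * t))).
Proof.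
move=> p1 c0; have q0 : 0 < p + 1 by lra.
(* The rate is [c / 2] because the denominator of the majorant is a square:
   [exp (- (c / 2) t) * (1 + u t) <= 1 + K] gets squared. *)
have [K K0 hK] := expR_lnM_le q0 (divr_gt0 c0 (ltr0Sn R 1)).
pose u t := expR ((p + 1) * ln t).
pose F t := - (1 + u t)^-1.
pose f t := expR (p * ln t) * (p + 1) / (1 + u t) ^+ 2.
have u0 t : 0 < u t by exact: expR_gt0.
have uE t : 0 < t -> u t = expR (p * ln t) * t.
  by move=> t0; rewrite /u mulrDl mul1r expRD lnK.
have du t : 0 < t -> is_derive t 1 u (expR (p * ln t) * (p + 1)).
  move=> t0; have dl := is_derive1_ln t0.
  apply: is_derive_eq; rewrite -[expR _]/(u t) uE// /GRing.scale/=; field.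
  by rewrite gt_eqF.
pose v t := 1 + u t.
have v0 t : v t != 0 by rewrite gt_eqF// addr_gt0.
have dv t : 0 < t -> is_derive t 1 v (expR (p * ln t) * (p + 1)).
  move=> t0; apply: (is_derive_eq (is_derive_add (is_derive_cst (1 : R) t 1)
    (du t t0))).
  by rewrite add0r.
have fi : mu.-integrable Rpos (EFin \o f).
  apply: (@integrable_derivative_bounded _ f F 1).
  - move=> t t0; apply: (is_derive_eq (is_derive_opp (is_derive_inv (v0 t)
      (dv t t0)))).
    by rewrite mulNr opprK.
  - move=> t t0; apply: (@is_derive_cont _ _ _).
    have dp : is_derive t 1 (fun t => expR (p * ln t))
        (expR (p * ln t) * (p / t)).
      by have dl := is_derive1_ln t0; apply: is_derive_eq.
    have n2 : v t * v t != 0 by rewrite mulf_neq0.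
    have dvv := is_derive_mul (dv t t0) (dv t t0).
    have := is_derive_mul (is_derive_mul dp (is_derive_cst (p + 1) t 1))
      (@is_derive_inv _ (fun t => v t * v t) _ _ n2 dvv).
    exact.
  - by move=> t t0; rewrite /f mulr_ge0 ?mulr_ge0 ?expR_ge0 ?ltW// invr_gt0
      exprn_gt0// addr_gt0.
  - move=> t t0; have ut := ltW (u0 t);
      rewrite /F normrN ger0_norm ?invr_ge0 ?addr_ge0//.
    by rewrite invf_le1 ?addr_gt0// lerDl ltW.
have {fi} := integrableZl mRpos ((1 + K) ^+ 2 / (p + 1)) fi.
apply: integrable_le_gt0.
  by apply: measurable_funTS; apply: measurable_funM; [exact: measurable_expRln|
    apply: measurableT_comp => //; apply: measurableT_comp => //;
      exact: measurable_funM].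
move=> t t0; rewrite ger0_norm ?mulr_ge0 ?expR_ge0//.
rewrite /f (_ : _ / _ * _ = expR (p * ln t) * ((1 + K) / (1 + u t)) ^+ 2);
  last first.
  field.
  by rewrite -[1 + u t]/(v t) v0 gt_eqF.
rewrite ler_pM2l ?expR_gt0//.
have -> : expR (- (c * t)) = expR (- (c / 2 * t)) ^+ 2.
  by rewrite -expRM_natl; congr expR; field.
have ut := ltW (u0 t); have K0' := ltW K0.
rewrite ler_pXn2r ?nnegrE ?expR_ge0 ?divr_ge0 ?addr_ge0//.
rewrite ler_pdivlMr ?addr_gt0// mulrDr mulr1 lerD//; last by rewrite mulrC;
  exact: hK.
by rewrite expR_le1 oppr_le0 mulr_ge0 ?divr_ge0 ?(ltW c0) ?(ltW t0).
Qed.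

Lemma mellin_integrable_kernel p : -1 < p -> mellin_integrable p kernel.
Proof.
move=> /mellin_integrable_expR/(_ ltr01).
by apply: eq_mellin_integrable => t _; rewrite mul1r.
Qed.

Let w p t := expR (p * ln t) * kernel t.

Let is_derive_w p t : 0 < t ->
  is_derive t 1 (w (p + 1)) ((p + 1) * w p t - w (p + 1) t).
Proof.
move=> t0; have dl := is_derive1_ln t0.
apply: is_derive_eq.
rewrite /GRing.scale/= /w /kernel mulrDl mul1r expRD lnK//; field.
by rewrite gt_eqF.
Qed.

(** Bounding one more power, [t ^ (p + 2) * exp (- t) <= K], yields the decay [K / t]. *)
Let w_cvg_pinfty p : -1 < p -> w (p + 1) n.+2%:R @[n --> \oo] --> 0.
Proof.
move=> p1; have q0 : 0 < p + 2 by lra.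
have [K K0 hK] := expR_lnM_le q0 ltr01.
have cK : K * n.+2%:R^-1 @[n --> \oo] --> (0 : R).
  rewrite -[X in _ --> X](mulr0 K); apply: cvgMr.
  have := @cvg_harmonic R; rewrite -cvg_shiftS; exact.
apply: (squeeze_cvgr _ (cvg_cst 0) cK); apply: nearW => n.
rewrite mulr_ge0 ?expR_ge0//= ler_pdivlMr//.
have := hK n.+2%:R (ltr0Sn _ _); rewrite mul1r; apply: le_trans.
rewrite /w mulrAC ler_wpM2r ?expR_ge0// (_ : p + 2 = p + 1 + 1); last by lra.
by rewrite (mulrDl (p + 1)) mul1r expRD lnK ?posrE.
Qed.

Let w_cvg0 p : -1 < p -> w (p + 1) n.+2%:R^-1 @[n --> \oo] --> 0.
Proof.
move=> p1; have q0 : 0 < p + 1 by lra.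
have cK : n.+2%:R^-1 `^ (p + 1) @[n --> \oo] --> (0 : R).
  apply: (proj1 (cvg_at_rightP _ _ _) (powR_cvg0 q0)); split => [n|].
    by rewrite invr_gt0.
  have := @cvg_harmonic R; rewrite -cvg_shiftS; exact.
apply: (squeeze_cvgr _ (cvg_cst 0) cK); apply: nearW => n.
rewrite mulr_ge0 ?expR_ge0//= /w /powR invr_eq0 pnatr_eq0/=.
by rewrite ler_piMr ?expR_ge0// expR_le1 oppr_le0 invr_ge0.
Qed.

(** Integrates the derivative of [h t * t ^ (p + 1) * exp (- t)], which tends to 0 at both ends. The
    pair [h], [k] covers the cosine and sine of [q * ln t] in either order (up to the sign of [q]),
    and the constants 1 and 0. *)
Lemma Rintegral_kernel_by_parts p q (h k : R -> R) : -1 < p ->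
  (forall t, 0 < t -> is_derive t 1 h (q * k t / t)) ->
  (forall t, 0 < t -> {for t, continuous k}) ->
  measurable_fun setT h -> measurable_fun setT k ->
  (forall t, `|h t| <= 1) -> (forall t, `|k t| <= 1) ->
  \int[mu]_(t in Rpos) (h t * (expR ((p + 1) * ln t) * expR (- t))) =
  (p + 1) * \int[mu]_(t in Rpos) (h t * (expR (p * ln t) * expR (- t))) +
  q * \int[mu]_(t in Rpos) (k t * (expR (p * ln t) * expR (- t))).
Proof.
move=> p1 dh ck mh mk h1 k1.
have p2 : -1 < p + 1 by lra.
have wi := mellin_integrable_kernel p1.
have wi1 := mellin_integrable_kernel p2.
have Zi (c : R) (f : R -> R) : mu.-integrable Rpos (EFin \o f) ->
    mu.-integrable Rpos (EFin \o (fun t => c * f t)).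
  by move=> /(integrableZl mRpos c).
have Di (f g : R -> R) : mu.-integrable Rpos (EFin \o f) ->
    mu.-integrable Rpos (EFin \o g) ->
    mu.-integrable Rpos (EFin \o (fun t => f t + g t)).
  by move=> fi gi; exact: (integrableD mRpos fi gi).
have Bi (f g : R -> R) : mu.-integrable Rpos (EFin \o f) ->
    mu.-integrable Rpos (EFin \o g) ->
    mu.-integrable Rpos (EFin \o (fun t => f t - g t)).
  by move=> fi gi; exact: (integrableB mRpos fi gi).
have hi := integrable_bounded_mul mh h1 wi.
have ki := integrable_bounded_mul mk k1 wi.
have hi1 := integrable_bounded_mul mh h1 wi1.
pose F t := h t * w (p + 1) t.
pose f t := (p + 1) * (h t * w p t) + q * (k t * w p t) - h t * w (p + 1) t.
have Fl (u : nat -> R) : w (p + 1) (u n) @[n --> \oo] --> 0 ->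
    F (u n) @[n --> \oo] --> 0.
  move=> wu; apply/cvgr0Pnorm_le => e e0; near=> n.
  rewrite normrM; apply: (le_trans (ler_piMl _ (h1 _))) => //.
  by near: n; move/cvgr0Pnorm_le : wu; exact.
suff : \int[mu]_(t in Rpos) f t = 0 - 0.
  rewrite /f RintegralB//; last by apply: Di; exact: Zi.
  rewrite RintegralD//; try exact: Zi.
  by rewrite !RintegralZl// subr0 => /eqP; rewrite subr_eq0 => /eqP.
apply: (@integral_derivative _ f F).
- move=> t t0; apply: (is_derive_eq (is_derive_mul (dh t t0)
    (is_derive_w p t0))).
  have wE : w (p + 1) t = t * w p t.
    by rewrite /w mulrDl mul1r expRD lnK// mulrAC mulrC.
  by rewrite /f wE; field; rewrite gt_eqF.
- move=> t t0.
  have cw r : {for t, continuous (w r)}.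
    by rewrite -(subrK 1 r); exact: is_derive_cont (is_derive_w _ t0).
  have ch := is_derive_cont (dh t t0).
  apply: cvgB; last by apply: cvgM; [exact: ch|exact: cw].
  by apply: cvgD; apply: cvgMr; apply: cvgM;
    [exact: ch|exact: cw|exact: ck|exact: cw].
- by apply: Bi => //; apply: Di; exact: Zi.
- exact/Fl/w_cvg0.
- exact/Fl/w_cvg_pinfty.
Unshelve. all: by end_near. Qed.


Lemma mellin_kernelS s : -1 < complex.Re s ->
  mellin (s + 1) kernel = (s + 1) * mellin s kernel.
Proof.
case: s => p q /= p1; rewrite !mellinE/= addr0.
have dq t : 0 < t -> is_derive t 1 (fun t => q * ln t) (q / t).
  by move=> t0; have dl := is_derive1_ln t0; apply: is_derive_eq.
have mc := measurable_cosln q; have ms := measurable_sinln q.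
have c1 := cosln_le1 q; have s1 := sinln_le1 q.
rewrite (@Rintegral_kernel_by_parts p (- q) (fun t => cos
  (q * ln t)) _ p1 _ _ mc ms c1 s1).
- rewrite (@Rintegral_kernel_by_parts p q (fun t => sin
    (q * ln t)) _ p1 _ _ ms mc s1 c1).
  + by apply/eqP; rewrite eq_complex/=; apply/andP; split; apply/eqP;
    rewrite /kernel; ring.
  + by move=> t t0; apply: (is_derive_eq (is_derive_comp_sin (dq t t0))); ring.
  + by move=> t t0; exact: is_derive_cont (is_derive_comp_cos (dq t t0)).
- by move=> t t0; apply: (is_derive_eq (is_derive_comp_cos (dq t t0))); ring.
- by move=> t t0; exact: is_derive_cont (is_derive_comp_sin (dq t t0)).
Qed.

Let I p := \int[mu]_(t in Rpos) w p t.

Lemma Rintegral_kernelS p : -1 < p -> I (p + 1) = (p + 1) * I p.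
Proof.
move=> p1.
have E r : I r =
    \int[mu]_(t in Rpos) (cst 1 t * (expR (r * ln t) * expR (- t))).
  by apply: eq_Rintegral => t _; rewrite mul1r.
have d0 t : 0 < t -> is_derive t 1 (cst 1 : R -> R) (0 * cst 0 t / t).
  by move=> _; rewrite !mul0r; exact: is_derive_cst.
rewrite !E (Rintegral_kernel_by_parts p1 d0)//.
- by rewrite mul0r addr0.
- by move=> t _; exact: cvg_cst.
- by move=> t; rewrite normr1.
- by move=> t; rewrite normr0.
Qed.

Let Rintegral_kernel_gt0 p : 0 < p -> 0 < I p.
Proof.
move=> p0; have /mellin_integrable_kernel wi : -1 < p by lra.
have fI := integrable_fin_num mRpos wi.
have sub : (`[1, 2]%classic : set (measurableTypeR R)) `<=` Rpos.
  by move=> t; rewrite /= !in_itv/= andbT => /andP[+ _]; exact: lt_le_trans.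
have w0 t : 0 <= w p t by rewrite mulr_ge0 ?expR_ge0.
have h : ((expR (- 2))%:E <= \int[mu]_(t in Rpos) (w p t)%:E)%E.
  apply: (@le_trans _ _ (\int[mu]_(t in `[1%R, 2%R]) (w p t)%:E)%E); last first.
    apply: ge0_subset_integral => //; first exact: measurable_int wi.
    by move=> t _; rewrite lee_fin.
  have -> : (expR (- 2))%:E =
      (\int[mu]_(t in (`[1%R, 2%R]%classic : set (measurableTypeR R))) (expR
        (- 2))%:E)%E.
    rewrite integral_cst//= lebesgue_measure_itv/= lte_fin ltr1n -EFinB -EFinM.
    by congr (_%:E); lra.
  apply: ge0_le_integral => //.
  - exact: measurable_funS mRpos sub (measurable_int _ wi).
  - move=> t; rewrite /= in_itv/= => /andP[t1 t2].
    rewrite lee_fin -[leLHS]mul1r /w /kernel ler_pM ?expR_ge0//.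
      by rewrite -expR0 ler_expR mulr_ge0 ?ln_ge0// ltW.
    by rewrite ler_expR lerN2.
rewrite -lte_fin /I /Rintegral fineK//.
by apply: lt_le_trans h; rewrite lte_fin expR_gt0.
Qed.

(* [p + 1] is the mean of the density proportional to [w p], so that the means
   of [t / (p + 1)] and [(p + 1) / t] are [1] and [1 + 1 / p]. *)
Let Rintegral_cos_ge p q : 0 < p ->
  (1 - q ^+ 2 / (2 * p)) * I p <=
  \int[mu]_(t in Rpos) (cos (q * (ln t - ln (p + 1))) * w p t).
Proof.
move=> p0; have p1 : 0 < p + 1 by lra.
have wi r : -1 < r -> mu.-integrable Rpos (EFin \o w r).
  exact: mellin_integrable_kernel.
have Zi (c : R) (f : R -> R) : mu.-integrable Rpos (EFin \o f) ->
    mu.-integrable Rpos (EFin \o (fun t => c * f t)).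
  by move=> /(integrableZl mRpos c).
have w0i : mu.-integrable Rpos (EFin \o w p) by apply: wi; lra.
have w1i : mu.-integrable Rpos (EFin \o w (p + 1)) by apply: wi; lra.
have w2i : mu.-integrable Rpos (EFin \o w (p - 1)) by apply: wi; lra.
(* [g t] is [(1 - q ^ 2 / 2 * (y + 1 / y - 2)) * w p t] at [y = t / (p + 1)], the minorant given by
   [cos_ge] and [ln_sqr_le], with [t] and [1 / t] absorbed into the exponent of [w]; [p > 0] keeps
   [p - 1] above -1. *)
pose g t := (1 + q ^+ 2) * w p t -
  ((q ^+ 2 / 2 / (p + 1)) * w (p + 1) t + (q ^+ 2 / 2 * (p + 1)) * w (p - 1) t).
have si : mu.-integrable Rpos (EFin \o (fun t =>
    (q ^+ 2 / 2 / (p + 1)) * w (p + 1) t + (q ^+ 2 / 2 * (p + 1)) * w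
      (p - 1) t)).
  exact: (integrableD mRpos (Zi _ _ w1i) (Zi _ _ w2i)).
have -> : (1 - q ^+ 2 / (2 * p)) * I p = \int[mu]_(t in Rpos) g t.
  rewrite /g RintegralB//; last exact: Zi.
  rewrite RintegralD//; try exact: Zi.
  rewrite !RintegralZl// -!/(I _).
  have -> : I p = p * I (p - 1).
    by rewrite -[p in LHS](subrK 1) Rintegral_kernelS ?subrK//; lra.
  rewrite Rintegral_kernelS; last by lra.
  rewrite -[I p](_ : p * I (p - 1) = _); last first.
    by rewrite -[p in RHS](subrK 1) Rintegral_kernelS ?subrK//; lra.
  by field; apply/andP; split; rewrite gt_eqF.
apply: le_Rintegral => //.
- exact: (integrableB mRpos (Zi _ _ w0i) si).
- apply: (integrable_bounded_mul
    (h := fun t => cos (q * (ln t - ln (p + 1)))) _ _ w0i).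
    apply: measurableT_comp.
      by apply: continuous_measurable_fun; exact: continuous_cos.
    by apply: measurable_funM => //; exact: measurable_funB.
  by move=> t; rewrite ler_norml cos_geN1 cos_le1.
- move=> t; rewrite /= in_itv/= andbT => t0.
  have w1E : w (p + 1) t = t * w p t.
    by rewrite /w mulrDl mul1r expRD lnK// mulrAC mulrC.
  have w2E : w (p - 1) t = w p t / t.
    by rewrite /w mulrBl mul1r expRB lnK// mulrAC.
  have -> : g t =
      (1 - q ^+ 2 / 2 * (t / (p + 1) + (t / (p + 1))^-1 - 2)) * w p t.
    rewrite /g w1E w2E; field.
    by apply/andP; split; rewrite gt_eqF.
  rewrite ler_wpM2r ?mulr_ge0 ?expR_ge0//; apply: le_trans (cos_ge _).
  have := ln_sqr_le (divr_gt0 t0 p1); rewrite ln_div ?posrE// => h.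
  by rewrite lerD2l lerN2 exprMn mulrAC ler_wpM2l// divr_ge0// sqr_ge0.
Qed.

(* A zero at [s] would give zeros at all [s + n]. *)
Lemma mellin_kernel_neq0 s : -1 < complex.Re s -> mellin s kernel != 0.
Proof.
move=> s1; apply/eqP => s0.
have mellin0 n : mellin (s + n%:R) kernel = 0.
  elim: n => [|n IH]; first by rewrite addr0.
  rewrite -natr1 addrA mellin_kernelS ?IH ?mulr0//.
  apply: (lt_le_trans s1); case: (s) => a b;
    rewrite -(rmorph_nat (real_complex R))/=.
  by rewrite lerDl.
(* The real shift keeps [q = Im s] and makes [p = Re s + n] exceed 0 and [q ^ 2], so that
   [1 - q ^ 2 / (2 p)] is positive. *)
set n := (Num.trunc (`|complex.Re s| + complex.Im s ^+ 2)).+1.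
have := mellin0 n; have -> : s + n%:R = (complex.Re s + n%:R) +i* complex.Im s.
  by case: (s) => a b; rewrite -(rmorph_nat (real_complex R)); apply/eqP;
    rewrite eq_complex/= addr0 !eqxx.
have : `|complex.Re s| + complex.Im s ^+ 2 < n%:R by exact: truncnS_gt.
move: (complex.Re s) (complex.Im s) (n%:R) => a q N aqN.
have : 0 < a + N /\ q ^+ 2 < a + N.
  by have := ler_norm (- a); rewrite normrN; have := sqr_ge0 q; split; lra.
move: (a + N) => p [p0 pq]; rewrite mellinE/= => /eqP; rewrite eq_complex/=.
move=> /andP[/eqP c0 /eqP d0].
have := Rintegral_cos_ge q p0.
(* Centring the phase at [ln (p + 1)] only forms a linear combination of the cosine and sine
   integrals, and both vanish. *)
suff -> : \int[mu]_(t in Rpos) (cos (q * (ln t - ln (p + 1))) * w p t) = 0.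
  rewrite leNgt mulr_gt0 ?Rintegral_kernel_gt0// subr_gt0 ltr_pdivrMr
    ?mulr_gt0//.
  by rewrite mul1r; lra.
have wi : mellin_integrable p kernel by apply: mellin_integrable_kernel; lra.
have ci := integrable_bounded_mul (measurable_cosln q) (cosln_le1 q) wi.
have di := integrable_bounded_mul (measurable_sinln q) (sinln_le1 q) wi.
transitivity (cos (q * ln (p + 1)) * \int[mu]_(t in Rpos) (cos
  (q * ln t) * w p t) +
  sin (q * ln (p + 1)) * \int[mu]_(t in Rpos) (sin (q * ln t) * w p t)).
  rewrite -!RintegralZl// -RintegralD//.
  - by apply: eq_Rintegral => t _; rewrite mulrBr cosB; ring.
  - exact: (integrableZl mRpos _ ci).
  - exact: (integrableZl mRpos _ di).
by rewrite c0 d0 !mulr0 addr0.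
Qed.

End gamma.

(** * The dilogarithm on [[0, 1[] *)

Section dilogarithm.
Variable R : realType.
Notation mu := (@lebesgue_measure R).
Implicit Types (u v w t : R) (n : nat).

Lemma is_derive_onem u : is_derive u 1 (fun t => 1 - t) (- 1).
Proof.
apply: (is_derive_eq (is_derive_add (is_derive_cst (1 : R) u 1)
  (is_derive_opp (is_derive_id u 1)))).
by rewrite add0r.
Qed.

Let f u := ln (1 - u) / u.

(** From [- ln (1 - u) = ln (1 + u / (1 - u)) <= u / (1 - u)]. The bound is uniform down to 0, where
    numerator and denominator of [f] both vanish. *)
Let f_bound u v : 0 < u -> u <= v -> v < 1 -> - (1 - v)^-1 <= f u <= 0.
Proof.
move=> u0 uv v1; have u1 : 0 < 1 - u by lra.
have l0 : ln (1 - u) <= 0 by apply: ln_le0; lra.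
apply/andP; split; last by rewrite mulr_le0_ge0// invr_ge0 ltW.
rewrite ler_pdivlMr// mulNr -lerN2 opprK.
have : - ln (1 - u) <= u / (1 - u).
  rewrite -lnV ?posrE// [X in ln X](_ : _ = 1 + u / (1 - u)); last first.
    by field; rewrite gt_eqF.
  by apply: le_ln1Dx; rewrite (lt_trans (ltrN10 R))// divr_gt0.
move=> /le_trans; apply; rewrite mulrC ler_wpM2r ?(ltW u0)//.
by rewrite lef_pV2 ?posrE//; lra.
Qed.

Let f_cont u : 0 < u < 1 -> {for u, continuous f}.
Proof.
move=> /andP[u0 u1]; have v0 : 0 < 1 - u by lra.
have d1 := is_derive_onem u.
have u0' : u != 0 by rewrite gt_eqF.
exact: is_derive_cont (is_derive_mul (@is_derive_comp_ln _
  (fun t => 1 - t) u _ v0 d1)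
  (@is_derive_inv _ id u 1 u0' (is_derive_id u 1))).
Qed.

Let f_integrable v : 0 <= v -> v < 1 -> mu.-integrable `[0, v] (EFin \o f).
Proof.
move=> v0 v1; apply: measurable_bounded_integrable => //.
- rewrite /= lebesgue_measure_itv/=; case: ifPn => _; last by rewrite ltry.
  by rewrite -EFinB ltry.
- apply: (@measurable_fun_itv_cc _ _ _ false true).
  apply: (@measurable_funS _ _ R R (`]0, 1[%classic : set R)) => //.
    by move=> t /=; rewrite !in_itv/= => /andP[-> tv]; exact: lt_trans tv v1.
  apply: open_continuous_measurable_fun => // t.
  by rewrite inE/= in_itv/=; exact: f_cont.
- exists (1 - v)^-1; split; first exact: num_real.
  move=> M /ltW vM t; rewrite /= in_itv/= le_eqVlt => /andP[/predU1P[<-|t0] tv].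
    (* At the endpoint 0 the quotient is 0, since the inverse of 0 is 0. *)
    rewrite /f invr0 mulr0 normr0 (le_trans _ vM)// invr_ge0; lra.
  have /andP[fl fu] := f_bound t0 tv v1.
  by apply: le_trans vM; rewrite ler_norml fl (le_trans fu)// invr_ge0; lra.
Qed.

(* Equal to [Li2] for [0 <= w] only. For [w < 0] the interval is empty and the
   value is [0], which makes [dilog] continuous at [0] from both sides. *)
Definition dilog w : R := - \int[mu]_(u in `[0, w]) (ln (1 - u) / u).

Lemma Li2E w : 0 <= w -> Li2 w = dilog w.
Proof. by rewrite /Li2 => ->. Qed.

Lemma dilog0 : dilog 0 = 0.
Proof. by rewrite /dilog set_itv1 Rintegral_set1 oppr0. Qed.

Lemma is_derive_dilog w : 0 < w < 1 -> is_derive w 1 dilog (- ln (1 - w) / w).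
Proof.
(* Any [u] strictly between [w] and 1 works: [w] must be interior to an interval on which [f] is
   integrable. *)
move=> /andP[w0 w1]; pose u := (w + 1) / 2.
have u0 : 0 <= u by rewrite /u; lra.
have wu : w < u by rewrite /u; lra.
have u1 : u < 1 by rewrite /u; lra.
have fw : {for w, continuous f} by apply: f_cont; rewrite w0.
have [dF F'] := continuous_FTC1_closed wu (f_integrable u0 u1) w0 fw.
have dd := DeriveDef dF (etrans (esym (derive1E _ _)) F').
exact: (is_derive_eq (is_derive_opp dd) (esym (mulNr _ _))).
Qed.

Lemma continuous_dilog w : 0 <= w -> w < 1 ->
  {within `[0, w], continuous dilog}.
Proof.
move=> w0 w1 t; have h := parameterized_integral_continuous w0
  (f_integrable w0 w1).
exact: (cvgN (h t)).
Qed.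

End dilogarithm.

(** * Power series of the logarithm and the dilogarithm *)

Section power_series.
Variable R : realType.
Implicit Types (u v w t x : R) (n : nat).

Let lsum n t := \sum_(0 <= k < n) (t ^+ k.+1 / k.+1%:R).
Let dsum n t := \sum_(0 <= k < n) (t ^+ k.+1 / k.+1%:R ^+ 2).

Let is_derive_powS n t : is_derive t 1 (fun t => t ^+ n.+1) (n.+1%:R * t ^+ n).
Proof.
elim: n => [|n IH]; first exact: (is_derive_eq (is_derive_id t 1) (esym
  (mulr1 _))).
apply: (is_derive_eq (is_derive_mul (is_derive_id t 1) IH)).
by rewrite mul1r mulrCA -!exprS -[n.+2%:R]natr1; ring.
Qed.

Let is_derive_lsum n t : is_derive t 1 (lsum n) (\sum_(0 <= k < n) t ^+ k).
Proof.
elim: n => [|n IH].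
  rewrite big_nil (_ : lsum 0 = cst 0); first exact: is_derive_cst.
  by apply/funext => x; rewrite /lsum big_nil.
rewrite big_nat_recr//=
  (_ : lsum n.+1 = fun t => lsum n t + t ^+ n.+1 * n.+1%:R^-1).
  apply: (is_derive_eq (is_derive_add IH (is_derive_mul (is_derive_powS n t)
     (is_derive_cst (n.+1%:R^-1 : R) t 1)))).
  by rewrite mulr0 addr0 mulrAC divff// mul1r.
by apply/funext => x; rewrite /lsum big_nat_recr.
Qed.

Let is_derive_dsum n t :
  is_derive t 1 (dsum n) (\sum_(0 <= k < n) (t ^+ k / k.+1%:R)).
Proof.
elim: n => [|n IH].
  rewrite big_nil (_ : dsum 0 = cst 0); first exact: is_derive_cst.
  by apply/funext => x; rewrite /dsum big_nil.
rewrite (_ : dsum n.+1 = fun t => dsum n t + t ^+ n.+1 * (n.+1%:R ^+ 2)^-1).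
  apply: (is_derive_eq (is_derive_add IH (is_derive_mul (is_derive_powS n t)
     (is_derive_cst ((n.+1%:R ^+ 2)^-1 : R) t 1)))).
  rewrite mulr0 addr0 big_nat_recr//=; congr (_ + _).
  have : n.+1%:R != 0 :> R by rewrite pnatr_eq0.
  by move: (n.+1%:R : R) => a a0; field.
by apply/funext => x; rewrite /dsum big_nat_recr.
Qed.

Let lsumE n t : t != 0 -> \sum_(0 <= k < n) (t ^+ k / k.+1%:R) = lsum n t / t.
Proof.
move=> t0; rewrite /lsum mulr_suml; apply: eq_bigr => k _.
by rewrite exprS [RHS]mulrC !mulrA mulVf// mul1r.
Qed.

Let geometric n t : t != 1 -> \sum_(0 <= k < n) t ^+ k = (1 - t ^+ n) / (1 - t).
Proof.
move=> t1; have t1' : 1 - t != 0 by rewrite subr_eq0 eq_sym.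
apply: (mulIf t1'); rewrite divfK//; elim: n => [|n IH].
  by rewrite big_nil mul0r subrr.
by rewrite big_nat_recr//= mulrDl IH exprS; ring.
Qed.

(** By the geometric sum the remainder has derivative [t ^ n / (1 - t)], so it equals
    [c ^ n / (1 - c) * u] for some [c] between 0 and [u]. *)
Lemma ln_onem_remainder n u : 0 <= u -> u < 1 ->
  0 <= - ln (1 - u) - \sum_(0 <= k < n) (u ^+ k.+1 / k.+1%:R) <=
  u ^+ n.+1 / (1 - u).
Proof.
rewrite le_eqVlt => /predU1P[<- _|u0 u1].
  rewrite subr0 ln1 oppr0 big1 ?subrr ?expr0n/= ?mul0r ?lexx//.
  by move=> k _; rewrite expr0n mul0r.
pose F t := - ln (1 - t) - lsum n t.
have dF t : t < 1 -> is_derive t 1 F (t ^+ n / (1 - t)).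
  move=> t1; have t1' : 0 < 1 - t by lra.
  apply: (is_derive_eq (is_derive_add (is_derive_opp
    (@is_derive_comp_ln _ (fun t => 1 - t) _ _ t1' (is_derive_onem t)))
    (is_derive_opp (is_derive_lsum n t)))).
  by rewrite geometric ?lt_eqF//; field; rewrite gt_eqF.
have [c /andP[c0 cu]] : exists2 c, 0 < c < u & F u - F 0 = c ^+ n / (1 - c) * u.
  apply: MVT0 => // [t /andP[_ tu]|]; first by apply: dF; lra.
  apply: derivable_within_continuous => t; rewrite in_itv/= => /andP[_ tu].
  by have [] := dF t (le_lt_trans tu u1).
have -> : F 0 = 0.
  rewrite /F subr0 ln1 oppr0 sub0r /lsum big1 ?oppr0// => k _.
  by rewrite expr0n mul0r.
rewrite subr0 -/(F u) => ->; have c1 : 0 < 1 - c by lra.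
have [[[c0' u0'] c1'] cu'] := (ltW c0, ltW u0, ltW c1, ltW cu).
rewrite mulr_ge0 ?divr_ge0 ?exprn_ge0//= exprSr mulrAC.
apply: ler_pM; rewrite ?invr_ge0 ?mulr_ge0 ?exprn_ge0//.
  by rewrite ler_wpM2r// lerXn2r.
by rewrite lef_pV2 ?posrE//; lra.
Qed.

(** The derivative of this remainder is the logarithmic remainder divided by [t]; after the mean
    value theorem, [ln_onem_remainder] provides the power of [c] that the division consumes. *)
Lemma dilog_remainder n u : 0 <= u -> u < 1 ->
  0 <= dilog u - \sum_(0 <= k < n) (u ^+ k.+1 / k.+1%:R ^+ 2) <=
  u ^+ n.+1 / (1 - u).
Proof.
rewrite le_eqVlt => /predU1P[<- _|u0 u1].
  rewrite subr0 dilog0 big1 ?subrr ?expr0n/= ?mul0r ?lexx//.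
  by move=> k _; rewrite expr0n mul0r.
pose F t := dilog t - dsum n t.
have dF t : 0 < t < 1 -> is_derive t 1 F ((- ln (1 - t) - lsum n t) / t).
  move=> t01; have /andP[t0 t1] := t01; have t0' : t != 0 by rewrite gt_eqF.
  apply: (is_derive_eq (is_derive_add (is_derive_dilog t01)
    (is_derive_opp (is_derive_dsum n t)))).
  by rewrite lsumE// mulrBl.
have [c /andP[c0 cu]] :
    exists2 c, 0 < c < u & F u - F 0 = (- ln (1 - c) - lsum n c) / c * u.
  apply: MVT0 => // [t /andP[t0 tu]|].
    by apply: dF; rewrite t0 (lt_trans tu u1).
  have cs : {within `[0, u], continuous (dsum n)}.
    by apply: derivable_within_continuous => x _; have [] := is_derive_dsum n x.
  exact: (within_continuousB (continuous_dilog (ltW u0) u1) cs).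
have -> : F 0 = 0.
  rewrite /F dilog0 sub0r /dsum big1 ?oppr0// => k _.
  by rewrite expr0n mul0r.
have cu1 : c < 1 by lra.
have /andP[l0 l1] := ln_onem_remainder n (ltW c0) cu1.
rewrite subr0 -/(F u) => ->; have c1 : 0 < 1 - c by lra.
have [[[c0' u0'] c1'] cu'] := (ltW c0, ltW u0, ltW c1, ltW cu).
rewrite mulr_ge0 ?divr_ge0//= exprSr [leRHS]mulrAC ler_wpM2r// ler_pdivrMr//.
apply: (le_trans l1); rewrite exprSr mulrAC ler_wpM2r//.
apply: ler_pM; rewrite ?invr_ge0 ?exprn_ge0//; first by rewrite lerXn2r.
by rewrite lef_pV2 ?posrE//; lra.
Qed.

Let cvg_remainder u (a : nat -> R) l : 0 <= u -> u < 1 ->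
  (forall n, 0 <= l - a n <= u ^+ n.+1 / (1 - u)) -> a n @[n --> \oo] --> l.
Proof.
move=> u0 u1 al.
have cl : l - a n @[n --> \oo] --> (0 : R).
  have cu : u ^+ n.+1 / (1 - u) @[n --> \oo] --> (0 : R).
    rewrite -[X in _ --> X](mul0r (1 - u)^-1); apply: cvgMl.
    have := @cvg_expr R u; rewrite ger0_norm// => /(_ u1).
    by rewrite -cvg_shiftS.
  by apply: (squeeze_cvgr _ (cvg_cst 0) cu); exact: nearW.
have -> : a = (fun n => l - (l - a n)) by apply/funext => n; ring.
by rewrite -[X in _ --> X]subr0; apply: cvgB => //; exact: cvg_cst.
Qed.

Lemma cvg_series_ln_onem u : 0 <= u -> u < 1 ->
  series (fun k => u ^+ k.+1 / k.+1%:R) n @[n --> \oo] --> - ln (1 - u).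
Proof.
by move=> u0 u1; apply: (cvg_remainder u0 u1) => n;
  exact: (ln_onem_remainder n u0 u1).
Qed.

Lemma cvg_series_dilog u : 0 <= u -> u < 1 ->
  series (fun k => u ^+ k.+1 / k.+1%:R ^+ 2) n @[n --> \oo] --> dilog u.
Proof.
by move=> u0 u1; apply: (cvg_remainder u0 u1) => n;
  exact: (dilog_remainder n u0 u1).
Qed.

Lemma dilog_bound u : 0 <= u -> u < 1 -> 0 <= dilog u <= u / (1 - u).
Proof.
by move=> u0 u1; have := dilog_remainder 0 u0 u1; rewrite big_nil subr0 expr1.
Qed.

(** Termwise, [1 / k ^ 2 <= 1 / k]. Integrability thus passes from [logkernel] to [dikernel]. *)
Lemma dilog_le u : 0 <= u -> u < 1 -> dilog u <= - ln (1 - u).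
Proof.
move=> u0 u1; have cd := cvg_series_dilog u0 u1;
  have cl := cvg_series_ln_onem u0 u1.
rewrite -(cvg_lim _ cd)// -(cvg_lim _ cl)//; apply: ler_lim.
- by apply/cvg_ex; eexists; exact: cd.
- by apply/cvg_ex; eexists; exact: cl.
- apply: nearW => n; apply: ler_sum => k _.
  rewrite ler_wpM2l ?exprn_ge0// lef_pV2 ?posrE ?exprn_gt0//.
  by rewrite -{1}[k.+1%:R]expr1 ler_weXn2l// ler1n.
Qed.

End power_series.

(** * Abel's five-term relation *)

Section abel.
Variable R : realType.
Implicit Types (a b t w : R).

Lemma continuous_dilog_lt1 w : 0 <= w -> w < 1 ->
  {for w, continuous (@dilog R)}.
Proof.
rewrite le_eqVlt => /predU1P[<- _|w0 w1]; last first.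
  by apply: is_derive_cont; apply: is_derive_dilog; rewrite w0.
rewrite /prop_for /continuous_at dilog0; apply/cvgr0Pnorm_le => e e0.
near=> t; have [t0|t0] := ltP t 0.
  rewrite /dilog set_itv_ge ?bnd_simp -?ltNge// Rintegral_set0 oppr0 normr0.
  exact: ltW.
(* Together, [t < 1 / 2] and [t < e / 2] give [t / (1 - t) <= e]. *)
have t2 : t < 2^-1.
  near: t; apply: (@lt_nbhsl _ (0 : R)); by rewrite invr_gt0.
have te : t < e / 2 by near: t; apply: (@lt_nbhsl _ (0 : R)); rewrite divr_gt0.
have t1 : t < 1 by lra.
have /andP[d0 d1] := dilog_bound t0 t1; rewrite ger0_norm//.
apply: (le_trans d1); rewrite ler_pdivrMr; last by lra.
by nra.
Unshelve. all: by end_near. Qed.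

Lemma is_derive_comp_dilog (f : R -> R) t a : 0 < f t < 1 ->
  is_derive t 1 f a ->
  is_derive t 1 (fun t => dilog (f t)) (- ln (1 - f t) / f t * a).
Proof. by move=> /is_derive_dilog df fa; apply: is_derive1_comp. Qed.

(* Both sides have the same derivative in [a], and both vanish at [a = 0]. *)
Lemma dilog_abel a b : 0 < a < 1 -> 0 < b < 1 ->
  dilog (b * (1 - a) / (1 - a * b)) + dilog (a * (1 - b) / (1 - a * b)) =
  dilog a + dilog b - dilog (a * b) -
  (ln (1 - a) - ln (1 - a * b)) * (ln (1 - b) - ln (1 - a * b)).
Proof.
move=> /andP[a0 a1] /andP[b0 b1].
pose v t := b * (1 - t) / (1 - t * b).
pose w t := t * (1 - b) / (1 - t * b).
(* The constant [dilog b] is left out of [G]; it comes back as [G 0 = - dilog b], because [v 0 = b]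
   and [w 0 = 0]. *)
pose G t := dilog t - dilog (t * b) - dilog (v t) - dilog (w t) -
  (ln (1 - t) - ln (1 - t * b)) * (ln (1 - b) - ln (1 - t * b)).
have tb t : 0 <= t -> t < 1 -> 0 < 1 - t * b by move=> t0 t1; nra.
have dtb t : is_derive t 1 (fun t => t * b) b.
  apply: (is_derive_eq (is_derive_mul (is_derive_id t 1)
    (is_derive_cst b t 1))).
  by rewrite mulr0 addr0 mul1r.
have d1tb t : is_derive t 1 (fun t => 1 - t * b) (- b).
  apply: (is_derive_eq (is_derive_add (is_derive_cst (1 : R) t 1)
    (is_derive_opp (dtb t)))).
  by rewrite add0r.
have dv t : 0 <= t -> t < 1 -> is_derive t 1 v (b * (b - 1) / (1 - t * b) ^+ 2).
  move=> t0 t1; have n0 : 1 - t * b != 0 by rewrite gt_eqF// tb.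
  apply: (is_derive_eq (is_derive_mul (is_derive_mul (is_derive_cst b t 1)
    (is_derive_onem t))
    (@is_derive_inv _ (fun t => 1 - t * b) _ _ n0 (d1tb t)))).
  by rewrite /cst/=; field.
have dw t : 0 <= t -> t < 1 -> is_derive t 1 w ((1 - b) / (1 - t * b) ^+ 2).
  move=> t0 t1; have n0 : 1 - t * b != 0 by rewrite gt_eqF// tb.
  apply: (is_derive_eq (is_derive_mul (is_derive_mul (is_derive_id t 1)
    (is_derive_cst (1 - b) t 1))
    (@is_derive_inv _ (fun t => 1 - t * b) _ _ n0 (d1tb t)))).
  by rewrite /cst/=; field.
have v01 t : 0 <= t -> t < 1 -> 0 < v t < 1.
  move=> t0 t1; have n0 := tb t t0 t1; rewrite /v; apply/andP; split.
    by rewrite divr_gt0// mulr_gt0//; lra.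
  by rewrite ltr_pdivrMr//; nra.
(* The lower bound is weak since [w 0 = 0]. At that point only continuity of [dilog] is available,
   which is enough for the closed interval. *)
have w01 t : 0 <= t -> t < 1 -> 0 <= w t < 1.
  move=> t0 t1; have n0 := tb t t0 t1; rewrite /w; apply/andP; split.
    by rewrite divr_ge0 ?mulr_ge0//; lra.
  by rewrite ltr_pdivrMr//; nra.
have dl1 t : t < 1 -> is_derive t 1 (fun t => ln (1 - t)) (- 1 / (1 - t)).
  move=> t1; have n0 : 0 < 1 - t by lra.
  exact: (@is_derive_comp_ln _ (fun t => 1 - t) _ _ n0 (is_derive_onem t)).
have dlb t : 0 <= t -> t < 1 ->
  is_derive t 1 (fun t => ln (1 - t * b)) (- b / (1 - t * b)).
  move=> t0 t1; exact: (@is_derive_comp_ln _ (fun t => 1 - t * b) _ _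
    (tb t t0 t1) (d1tb t)).
have dlog t : 0 <= t -> t < 1 -> is_derive t 1
    (fun t => (ln (1 - t) - ln (1 - t * b)) * (ln (1 - b) - ln (1 - t * b)))
    ((- 1 / (1 - t) - - b / (1 - t * b)) * (ln (1 - b) - ln (1 - t * b)) +
     (ln (1 - t) - ln (1 - t * b)) * (0 - - b / (1 - t * b))).
  move=> t0 t1; apply: is_derive_mul.
    exact: (is_derive_add (dl1 t t1) (is_derive_opp (dlb t t0 t1))).
  exact: (is_derive_add (is_derive_cst (ln (1 - b)) t 1) (is_derive_opp
    (dlb t t0 t1))).
have dG t : 0 < t < a -> is_derive t 1 G 0.
  move=> /andP[t0 ta]; have t1 : t < 1 by lra.
  have t01 : 0 < t < 1 by rewrite t0.
  have w01' : 0 < w t < 1.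
    have /andP[_ ->] := w01 t (ltW t0) t1; rewrite andbT /w divr_gt0 ?tb ?ltW//.
    by rewrite mulr_gt0//; lra.
  have tb01 : 0 < t * b < 1 by apply/andP; split; nra.
  have dd1 := is_derive_dilog t01.
  have dd2 := @is_derive_comp_dilog (fun t => t * b) t _ tb01 (dtb t).
  have dd3 := is_derive_comp_dilog (v01 t (ltW t0) t1) (dv t (ltW t0) t1).
  have dd4 := is_derive_comp_dilog w01' (dw t (ltW t0) t1).
  apply: (is_derive_eq (is_derive_add (is_derive_add (is_derive_add
    (is_derive_add dd1
    (is_derive_opp dd2)) (is_derive_opp dd3)) (is_derive_opp dd4))
    (is_derive_opp (dlog t (ltW t0) t1)))).
  have p0 := tb t (ltW t0) t1; have q0 : 0 < 1 - t by lra.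
  have r0 : 0 < 1 - b by lra.
  (* [1 - v t] and [1 - w t] are quotients of [1 - b], [1 - t] and [1 - t * b]. Only three
     logarithms remain, and the derivative cancels with these as free variables. *)
  have -> : ln (1 - v t) = ln (1 - b) - ln (1 - t * b).
    rewrite -ln_div ?posrE//; congr ln; rewrite /v; field.
    by rewrite gt_eqF.
  have -> : ln (1 - w t) = ln (1 - t) - ln (1 - t * b).
    rewrite -ln_div ?posrE//; congr ln; rewrite /w; field.
    by rewrite gt_eqF.
  rewrite /v /w; move: (ln _) (ln _) (ln _) => A B C; field.
  by rewrite !gt_eqF.
have cdilog (f : R -> R) t : {for t, continuous f} -> 0 <= f t < 1 ->
    {for t, continuous (fun t => dilog (f t))}.
  move=> cf /andP[f0 f1].
  exact: (@continuous_comp _ _ _ f (@dilog R) _ cf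
    (continuous_dilog_lt1 f0 f1)).
have cG : {within `[0, a], continuous G}.
  apply: continuous_in_subspaceT => t; rewrite inE/= in_itv/= => /andP[t0 ta].
  have t1 : t < 1 by lra.
  apply: cvgB; last exact: is_derive_cont (dlog t t0 t1).
  apply: cvgB; last exact: cdilog (is_derive_cont (dw t t0 t1)) (w01 t t0 t1).
  apply: cvgB.
    apply: cvgB; first exact: continuous_dilog_lt1.
    by apply: cdilog (is_derive_cont (dtb t)) _; apply/andP; split; nra.
  apply: cdilog (is_derive_cont (dv t t0 t1)) _.
  by have /andP[/ltW-> ->] := v01 t t0 t1.
have [c _] := MVT0 a0 dG cG; rewrite mul0r => /eqP; rewrite subr_eq0 => /eqP.
rewrite /G /v /w !mul0r !subr0 mulr1 invr1 mulr1 dilog0 ln1 subrr mul0r.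
by move=> /eqP h; apply/eqP; move: h; lra.
Qed.

End abel.

(** * Integrability of the logarithmic and dilogarithmic kernels *)

Section log_kernel.
Variable R : realType.
Notation mu := (@lebesgue_measure R).
Local Notation Rpos := (`]0, +oo[%classic : set (measurableTypeR R)).
Implicit Types (p c d e t : R).

(** For [c = 1], [x], [x + 1] the logarithm is taken at [1 - a], [1 - b], [1 - a * b], where
    [a = exp (- t)] and [b = exp (- x * t)]. Rescaling [t] by [k] multiplies [c] by [k], so the
    family is stable. *)
Definition logkernel c t := - ln (1 - expR (- (c * t))).

Definition dikernel c t := dilog (expR (- (c * t))).

Lemma expRN_mul_lt1 c t : 0 < c -> 0 < t -> expR (- (c * t)) < 1.
Proof. by move=> c0 t0; rewrite expR_lt1 oppr_lt0 mulr_gt0. Qed.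

Lemma logkernel_ge0 c t : 0 < c -> 0 < t -> 0 <= logkernel c t.
Proof.
move=> c0 t0; rewrite oppr_ge0 ln_le0// gerBl expR_ge0//.
Qed.

(* Applies [y <= exp y - 1] to [y = - e * ln (1 - u)], with [u = exp (- t)] and
   [t * u <= 1 - u]. *)
Lemma logkernel_le e t : 0 < e -> e <= 1 -> 0 < t ->
  logkernel 1 t <= e^-1 * (expR (- (e * ln t)) * expR (- ((1 - e) * t))).
Proof.
move=> e0 e1 t0; rewrite /logkernel mul1r; set u := expR (- t).
have u0 : 0 < u by exact: expR_gt0.
have u1 : u < 1 by rewrite /u expR_lt1 oppr_lt0.
have ut : t * u <= 1 - u.
  rewrite /u expRN lerBrDr -[X in _ + X]mul1r -mulrDl ler_pdivrMr ?expR_gt0//.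
  by rewrite mul1r addrC expR_ge1Dx.
have v0 : 0 < 1 - u by lra.
have l0 : ln (1 - u) <= 0 by apply: ln_le0; lra.
set E := expR (- (e * ln (1 - u))).
have h1 : - (e * ln (1 - u)) <= E * u.
  have := expR_ge1Dx (- (e * ln (1 - u))); rewrite -/E => h.
  apply: (@le_trans _ _ (E - 1)); first by lra.
  (* [E * (1 - u)] is [(1 - u) ^ (1 - e)], at most 1 as [e <= 1]. The factor [u] gained in
     [E - 1 <= E * u] provides the decay at infinity. *)
  suff : E * (1 - u) <= 1 by lra.
  rewrite /E expRN mulrC ler_pdivrMr ?expR_gt0// mul1r.
  rewrite -[leLHS]lnK ?posrE// ler_expR; nra.
have h2 : E <= expR (- (e * ln t)) * expR (e * t).
  rewrite -expRD ler_expR.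
  have : ln (t * u) <= ln (1 - u) by rewrite ler_ln ?posrE// mulr_gt0.
  rewrite lnM ?posrE// /u expRK; nra.
rewrite ler_pdivlMl//; apply: (@le_trans _ _ (E * u)); first by lra.
apply: (@le_trans _ _ (expR (- (e * ln t)) * expR (e * t) * u)).
  by rewrite ler_wpM2r// ltW.
by rewrite -mulrA ler_wpM2l ?expR_ge0// /u -expRD ler_expR; lra.
Qed.

Lemma mellin_integrable_powexp p d c : -1 < p - d -> 0 < c ->
  mellin_integrable p (fun t => expR (- (d * ln t)) * expR (- (c * t))).
Proof.
move=> pd c0; have := mellin_integrable_expR pd c0.
by apply: eq_integrable => // t _; congr (_%:E); rewrite mulrBl expRD mulrA.
Qed.

Lemma measurable_logkernel c : measurable_fun setT (logkernel c).
Proof.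
apply: measurableT_comp => //; apply: measurableT_comp => //.
apply: measurable_funB => //; apply: measurableT_comp => //.
by apply: measurableT_comp => //; exact: measurable_funM.
Qed.

(** One logarithmic kernel costs [t ^ (- e)] at 0, a product of two costs [t ^ (- (e + e))]. The
    witness [q / (2 q + 4)], with [q = p + 1], is below both 1 and [q / 2]. *)
Let eps p : -1 < p -> exists e : R, [/\ 0 < e, e < 1, -1 < p -
  (e + e) & -1 < p - e].
Proof.
move=> p1; have q0 : 0 < 2 * (p + 1) + 4 by lra.
have e0 : 0 < (p + 1) / (2 * (p + 1) + 4) by rewrite divr_gt0//; lra.
have e1 : (p + 1) / (2 * (p + 1) + 4) < 1 by rewrite ltr_pdivrMr//; lra.
have e2 : (p + 1) / (2 * (p + 1) + 4) * 2 < p + 1.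
  by rewrite mulrAC ltr_pdivrMr//; nra.
by exists ((p + 1) / (2 * (p + 1) + 4)); split => //; lra.
Qed.

Lemma mellin_integrable_logkernel p c : -1 < p -> 0 < c ->
  mellin_integrable p (logkernel c).
Proof.
move=> p1 c0; suff h : mellin_integrable p (logkernel 1).
  apply: eq_mellin_integrable (mellin_integrable_scale c0 h) => t _.
  by rewrite /logkernel mul1r.
have [e [e0 e1 _ pe]] := eps p1; have e1' : 0 < 1 - e by lra.
apply: mellin_integrable_le (mellin_integrableZ e^-1
  (mellin_integrable_powexp pe e1')).
  exact: measurable_funTS (measurable_logkernel 1).
by move=> t t0; rewrite ger0_norm ?logkernel_ge0// logkernel_le// ltW.
Qed.

(** Squares suffice, by [x * y <= x ^ 2 + y ^ 2], and rescaling reduces them to [c = 1]. *)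
Lemma mellin_integrable_logkernelM p c d : -1 < p -> 0 < c -> 0 < d ->
  mellin_integrable p (fun t => logkernel c t * logkernel d t).
Proof.
move=> p1 c0 d0.
have sq : mellin_integrable p (fun t => logkernel 1 t ^+ 2).
  have [e [e0 e1 pe _]] := eps p1; have e1' : 0 < (1 - e) + (1 - e) by lra.
  apply: mellin_integrable_le (mellin_integrableZ (e^-1 ^+ 2)
    (mellin_integrable_powexp pe e1')).
    apply: measurable_funTS; apply: measurable_funX;
      exact: measurable_logkernel.
  move=> t t0; rewrite ger0_norm ?sqr_ge0//.
  have := logkernel_le e0 (ltW e1) t0; have := logkernel_ge0 ltr01 t0.
  rewrite (mulrDl e e) (mulrDl (1 - e) (1 - e)) !(opprD (_ * _)) !expRD.
  move: (logkernel 1 t) (e^-1) (expR (- (e * ln t))) (expR (-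
    ((1 - e) * t))) => a b x y a0 ab.
  have -> : b ^+ 2 * (x * x * (y * y)) = (b * (x * y)) ^+ 2 by ring.
  by rewrite lerXn2r// nnegrE (le_trans a0).
have sqc k : 0 < k -> mellin_integrable p (fun t => logkernel k t ^+ 2).
  move=> k0; apply: eq_mellin_integrable (mellin_integrable_scale k0 sq) => t _.
  by rewrite /logkernel mul1r.
apply: mellin_integrable_le (mellin_integrableD (sqc c c0) (sqc d d0)).
  by apply: measurable_funTS; apply: measurable_funM;
    exact: measurable_logkernel.
move=> t t0; rewrite ger0_norm ?mulr_ge0 ?logkernel_ge0//.
have := sqr_ge0 (logkernel c t - logkernel d t).
have := logkernel_ge0 c0 t0; have := logkernel_ge0 d0 t0.
by move: (logkernel c t) (logkernel d t) => x y; nra.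
Qed.

Lemma mellin_integrable_dikernel p c : -1 < p -> 0 < c ->
  mellin_integrable p (dikernel c).
Proof.
move=> p1 c0; apply: mellin_integrable_le (mellin_integrable_logkernel p1 c0).
  apply: continuous_gt0_measurable => t t0.
  have dc : is_derive t 1 (fun t => expR (- (c * t))) (- c * expR (- (c * t))).
    by apply: is_derive_eq; rewrite /GRing.scale/= mulr1 mulrN mulrC mulNr.
  apply: (@continuous_comp _ _ _ (fun t => expR (- (c * t))) (@dilog R) t
    (is_derive_cont dc)).
  by apply: continuous_dilog_lt1; rewrite ?expR_ge0 ?expRN_mul_lt1.
move=> t t0; have u1 := expRN_mul_lt1 c0 t0; have u0 := expR_ge0 (- (c * t)).
by have /andP[d0 _] := dilog_bound u0 u1; rewrite ger0_norm// dilog_le.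
Qed.

End log_kernel.

(** * Theta, zeta and the dilogarithm integral as Mellin transforms *)

Section theta_zeta.
Variable R : realType.
Local Notation Rpos := (`]0, +oo[%classic : set (measurableTypeR R)).
Variable z : R[i].
Hypothesis z_gt1 : 1 < complex.Re z.

Let s := z - 2.

Let Re_s : -1 < complex.Re s.
Proof.
by rewrite /s; case: z z_gt1 => a b /= a1; lra.
Qed.

Let exponentE : - s - 1 = 1 - z. Proof. by rewrite /s; ring. Qed.

Lemma Gamma_mellin : Gamma (z - 1) = mellin s (fun t => expR (- t)).
Proof. by rewrite /s (_ : z - 2 = z - 1 - 1)//; ring. Qed.

Lemma Gamma_neq0 : Gamma (z - 1) != 0.
Proof. by rewrite Gamma_mellin; exact: mellin_kernel_neq0. Qed.

(** Euler's integral rescaled: it turns the terms of the series for zeta and Theta into transforms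
    of exponentials. *)
Lemma cpow_mellin (k : R) : 0 < k ->
  cpow k (1 - z) = (Gamma (z - 1))^-1 * mellin s (fun t => expR (- (k * t))).
Proof.
move=> k0; rewrite (mellin_scale k0 (mellin_integrable_kernel Re_s)) exponentE.
by rewrite -Gamma_mellin mulrCA mulVf ?mulr1// Gamma_neq0.
Qed.

Let natC_real (n : nat) : (n%:R : R[i]) = (n%:R : R)%:C.
Proof. by rewrite rmorph_nat. Qed.

Let expR_series c (n : nat) (t : R) :
  expR (- (c * t)) ^+ n = expR (- (n%:R * c * t)).
Proof. by rewrite -expRM_natl mulrN mulrA. Qed.

Let measurable_expX c (n : nat) (r : R) :
  measurable_fun Rpos (fun t : R => expR (- (c * t)) ^+ n / r).
Proof.
apply: measurable_funTS; apply: measurable_funM => //; apply: measurable_funX.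
by apply: measurableT_comp => //; exact: measurableT_comp.
Qed.

Let expX_ge0 c (n : nat) (t r : R) : 0 <= r -> 0 <= expR (- (c * t)) ^+ n / r.
Proof. by move=> r0; rewrite divr_ge0 ?exprn_ge0 ?expR_ge0. Qed.

Let cvg_logkernel c (t : R) : 0 < c -> 0 < t ->
  series (fun n => expR (- (c * t)) ^+ n.+1 / n.+1%:R) n @[n --> \oo] -->
  logkernel c t.
Proof.
by move=> c0 t0; apply: cvg_series_ln_onem; rewrite ?expR_ge0 ?expRN_mul_lt1.
Qed.

(** Split [n ^ (- z - 1)] as [n ^ (- 2) * n ^ (1 - z)]: the second factor gives [exp (- n * t)]
    under the integral, the first makes the sum there a dilogarithm series. *)
Lemma zeta_mellin :
  zeta (z + 1) = (Gamma (z - 1))^-1 * mellin s (dikernel 1).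
Proof.
pose f n (t : R) := expR (- (1 * t)) ^+ n.+1 / n.+1%:R ^+ 2.
have := @mellin_series _ s f (dikernel 1) _ _ _
  (mellin_integrable_dikernel Re_s ltr01).
move=> /(_ (fun n => measurable_expX _ _ _)).
have f0 n (t : R) : 0 < t -> 0 <= f n t by move=> _; rewrite expX_ge0.
have fc (t : R) : 0 < t -> series (f ^~ t) n @[n --> \oo] --> dikernel 1 t.
  by move=> t0; apply: cvg_series_dilog; rewrite ?expR_ge0 ?expRN_mul_lt1.
move=> /(_ f0 fc) /cseriesZ <-; congr cseries; apply/funext => n.
have n0 : 0 < n.+1%:R :> R by [].
transitivity ((n.+1%:R ^-2)%:C * ((Gamma (z - 1))^-1 *
    mellin s (fun t => expR (- (n.+1%:R * t))))).
  rewrite -cpow_mellin// (_ : z + 1 = - (1 - z) + 1 + 1); last by ring.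
  rewrite 2!cpowD cpowN cpowr1// div1r -mulrA invfM invrK mulrC.
  by rewrite fmorphV rmorphXn expr2.
rewrite mulrCA -mellinZ; last by apply: mellin_integrable_expR.
congr (_ * _); apply: eq_mellin => t _.
by rewrite /f expR_series mulr1 mulrC.
Qed.

(** The exponential [exp (- (n + m * x) * t)] factors, so the double sum becomes a product of two
    logarithm series. As [Theta] is an iterated limit, the sums over [m] and over [n] are
    interchanged with the integral separately. *)
Lemma Theta_mellin x : 0 < x ->
  Theta z x =
  (Gamma (z - 1))^-1 * mellin s (fun t => logkernel 1 t * logkernel x t).
Proof.
move=> x0.
pose F n (t : R) := expR (- (1 * t)) ^+ n.+1 / n.+1%:R * logkernel x t.
pose f n m (t : R) := expR (- (1 * t)) ^+ n.+1 / n.+1%:R *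
  (expR (- (x * t)) ^+ m.+1 / m.+1%:R).
have mF n : measurable_fun Rpos (F n).
  by apply: measurable_funM => //;
    exact: measurable_funTS (measurable_logkernel x).
have F0 n (t : R) : 0 < t -> 0 <= F n t.
  by move=> t0; rewrite mulr_ge0 ?expX_ge0 ?logkernel_ge0.
have Fc (t : R) : 0 < t ->
    series (F ^~ t) n @[n --> \oo] --> logkernel 1 t * logkernel x t.
  move=> t0; rewrite (_ : series _ = fun n =>
      series (fun n => expR (- (1 * t)) ^+ n.+1 / n.+1%:R) n * logkernel x t).
    by apply: cvgMl; exact: cvg_logkernel.
  by apply/funext => n; rewrite /series/= mulr_suml.
have ABi := mellin_integrable_logkernelM Re_s ltr01 x0.
(* A single term of a nonnegative series is below its sum; this makes [F n] integrable, as the inner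
   interchange requires. *)
have term_le (t : R) n : 0 < t -> F n t <= logkernel 1 t * logkernel x t.
  move=> t0; rewrite /F ler_wpM2r ?logkernel_ge0//.
  have := ln_onem_remainder n.+1 (expR_ge0 (- (1 * t)))
    (expRN_mul_lt1 ltr01 t0).
  rewrite subr_ge0 => /andP[+ _]; apply: le_trans.
  by rewrite big_nat_recr//= lerDr sumr_ge0// => k _; rewrite expX_ge0.
have Fi n : mellin_integrable (complex.Re s) (F n).
  apply: mellin_integrable_le ABi => // t t0.
  by rewrite ger0_norm ?F0// term_le.
have := mellin_series mF F0 Fc ABi => /cseriesZ <-.
congr cseries; apply/funext => n.
have mf m : measurable_fun Rpos (f n m) by exact: measurable_funM.
have f0 m (t : R) : 0 < t -> 0 <= f n m t.
  by move=> t0; rewrite mulr_ge0 ?expX_ge0.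
have fc (t : R) : 0 < t -> series (fun m => f n m t) m @[m --> \oo] --> F n t.
  move=> t0; rewrite (_ : series _ = fun m =>
      expR (- (1 * t)) ^+ n.+1 / n.+1%:R *
      series (fun m => expR (- (x * t)) ^+ m.+1 / m.+1%:R) m).
    by apply: cvgMr; exact: cvg_logkernel.
  by apply/funext => m; rewrite /series/= mulr_sumr.
have := mellin_series mf f0 fc (Fi n) => /cseriesZ <-.
congr cseries; apply/funext => m.
have k0 : 0 < n.+1%:R + m.+1%:R * x by rewrite addr_gt0// mulr_gt0.
transitivity (((n.+1%:R * m.+1%:R)^-1)%:C * ((Gamma (z - 1))^-1 *
    mellin s (fun t => expR (- ((n.+1%:R + m.+1%:R * x) * t))))).
  rewrite -cpow_mellin// (_ : z - 1 = - (1 - z)); last by ring.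
  by rewrite cpowN div1r [LHS]invfM invrK !natC_real fmorphV rmorphM.
rewrite mulrCA -mellinZ; last by apply: mellin_integrable_expR.
congr (_ * _); apply: eq_mellin => t _.
rewrite /f !expR_series mulr1 mulrDl opprD expRD invfM; ring.
Qed.

Lemma mellin_dilog x : 0 < x ->
  mellin s (fun t => Li2 ((expR (- (x + 1) * t) - expR (- x * t))
              / (expR (- (x + 1) * t) - 1))
       + Li2 ((expR (- (x + 1) * t) - expR (- t))
              / (expR (- (x + 1) * t) - 1))) =
  mellin s (dikernel 1) + mellin s (dikernel x) - mellin s (dikernel (x + 1)) -
  (mellin s (fun t => logkernel 1 t * logkernel x t) -
   mellin s (fun t => logkernel 1 t * logkernel (x + 1) t) -
   mellin s (fun t => logkernel (x + 1) t * logkernel x t) +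
   mellin s (fun t => logkernel (x + 1) t * logkernel (x + 1) t)).
Proof.
move=> x0; have x1 : 0 < x + 1 by lra.
have iM c d := @mellin_integrable_logkernelM R _ c d Re_s.
have iD c := @mellin_integrable_dikernel R _ c Re_s.
rewrite -(mellinD (iD _ ltr01) (iD _ x0)).
rewrite -mellinB; [|by apply: mellin_integrableD; apply: iD|exact: iD].
rewrite -(mellinB (iM _ _ ltr01 x0) (iM _ _ ltr01 x1)).
have i1 := mellin_integrableB (iM _ _ ltr01 x0) (iM _ _ ltr01 x1).
rewrite -(mellinB i1 (iM _ _ x1 x0)).
have i2 := mellin_integrableB i1 (iM _ _ x1 x0).
rewrite -(mellinD i2 (iM _ _ x1 x1)).
have i3 := mellin_integrableD i2 (iM _ _ x1 x1).
rewrite -mellinB//; last first.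
  by apply: mellin_integrableB; [apply: mellin_integrableD|]; apply: iD.
apply: eq_mellin => t t0.
have E : expR (- ((x + 1) * t)) = expR (- t) * expR (- (x * t)).
  by rewrite -expRD; congr expR; ring.
rewrite /logkernel /dikernel mul1r !mulNr E.
have := expRN_mul_lt1 x0 t0; have := expRN_mul_lt1 ltr01 t0; rewrite mul1r.
have := expR_gt0 (- t); have := expR_gt0 (- (x * t)).
move: (expR (- t)) (expR (- (x * t))) => a b b0 a0 a1 b1.
have ab : 0 < 1 - a * b by nra.
(* Numerator and denominator are both negative; flipping the signs exhibits a nonnegative argument,
   where [Li2] is [dilog], in the form of [dilog_abel]. *)
have -> : (a * b - b) / (a * b - 1) = b * (1 - a) / (1 - a * b).
  by field; rewrite gt_eqF// lt_eqF//; lra.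
have -> : (a * b - a) / (a * b - 1) = a * (1 - b) / (1 - a * b).
  by field; rewrite gt_eqF// lt_eqF//; lra.
rewrite !Li2E; [|by rewrite divr_ge0 ?mulr_ge0//;
  lra|by rewrite divr_ge0 ?mulr_ge0//; lra].
by rewrite dilog_abel ?a0 ?b0//; ring.
Qed.

End theta_zeta.

Theorem theorem1p2 (R : realType) (z : R[i]) (x : R)
    (hz : 1 < complex.Re z) (hx : 0 < x) :
  Theta z x - Theta z (x + 1) - cpow (x + 1) (1 - z) * Theta z (x / (x + 1)) =
  - cpow (x + 1) (1 - z) * Theta z 1
  + (1 + cpow x (1 - z) - cpow (x + 1) (1 - z)) * zeta (z + 1)
  - 1 / Gamma (z - 1) *
    cintegral `]0, +oo[ (fun t =>
      cpow t (z - 2) *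
      (Li2 ((expR (- (x + 1) * t) - expR (- x * t))
              / (expR (- (x + 1) * t) - 1))
       + Li2 ((expR (- (x + 1) * t) - expR (- t))
              / (expR (- (x + 1) * t) - 1)))%:C).
Proof.
rewrite -/(mellin (z - 2) _) mellin_dilog//.
have x1 : 0 < x + 1 by lra.
have xx : 0 < x / (x + 1) by rewrite divr_gt0.
have Re_s : -1 < complex.Re (z - 2).
  by case: z hz => a b /= a1; lra.
have expE : 1 - z = - (z - 2) - 1 by ring.
rewrite !Theta_mellin// zeta_mellin//.
have iM c d := @mellin_integrable_logkernelM R _ c d Re_s.
have iD c := @mellin_integrable_dikernel R _ c Re_s.
have scaleM c d k : 0 < c -> 0 < d -> 0 < k ->
    cpow k (1 - z) * mellin (z - 2) (fun t => logkernel c t * logkernel d t) =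
    mellin (z - 2) (fun t => logkernel (c * k) t * logkernel (d * k) t).
  move=> c0 d0 k0; rewrite expE -(mellin_scale k0 (iM _ _ c0 d0)).
  by apply: eq_mellin => t _; rewrite /logkernel !mulrA.
have scaleD k : 0 < k -> cpow k (1 - z) * mellin (z - 2) (dikernel 1) =
    mellin (z - 2) (dikernel k).
  move=> k0; rewrite expE -(mellin_scale k0 (iD _ ltr01)).
  by apply: eq_mellin => t _; rewrite /dikernel mul1r.
(* Rescaling by [x + 1] carries the parameters [1, x / (x + 1)] to [x + 1, x] and [1, 1] to
   [x + 1, x + 1], the two remaining products in [mellin_dilog]. *)
have e1 := scaleM 1 (x / (x + 1)) (x + 1) ltr01 xx x1.
have e2 := scaleM 1 1 (x + 1) ltr01 ltr01 x1.
have e3 := scaleD x hx; have e4 := scaleD (x + 1) x1.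
rewrite divfK ?gt_eqF// mul1r in e1; rewrite !mul1r in e2.
rewrite mulrCA e1 mulNr mulrCA e2 (mulrCA (_ - _)) !mulrBl mulrDl mul1r e3 e4.
rewrite mul1r.
(* [g] is the inverse of Gamma; [a], [b], [c] mark the kernels with parameters 1, [x], [x + 1],
   paired for logarithmic products and prefixed by [d] for dilogarithms. *)
have algebra (g ab ac cb cc da db dc : R[i]) : g * ab - g * ac - g * cb =
    - (g * cc) + g * (da + db - dc) - g * (da + db - dc - (ab - ac - cb + cc)).
  by ring.
exact: algebra.
Qed.
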